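(* Let $X$ be a metric space and let $\mathscr{U}$ be a uniformly bounded open cover of $X$. Then the natural bijection $\mathrm{id}:|\mathcal{V}(\mathscr{U})|\to \mathcal{V}^m(\mathscr{U})$ from the geometric realization of the Vietoris complex of $\mathscr{U}$ to the Vietoris metric thickening of $\mathscr{U}$ is a weak homotopy equivalence.
   Context: Let $(X,d_X)$ be a metric space and $\mathscr{U}$ a cover of $X$. The cover $\mathscr{U}$ is uniformly bounded if there is $D<\infty$ with $\operatorname{diam}(U)\le D$ for all $U\in\mathscr{U}$. Vietoris complex: $\mathcal{V}(\mathscr{U})$ is the abstract simplicial complex with vertex set $X$ whose simplices are the finite sets $\sigma\subseteq X$ with $\sigma\subseteq U$ for some $U\in\mathscr{U}$. Its geometric realization $|\mathcal{V}(\mathscr{U})|$ is the set of functions $\alpha:X\to[0,1]$ such that $\{x:\alpha(x)\ne0\}$ is a simplex of $\mathcal{V}(\mathscr{U})$ and $\sum_{x\in X}\alpha(x)=1$, with the CW (weak) topology: a set $W$ is open iff $W\cap|\sigma|$ is open in $|\sigma|$ for every simplex $\sigma$, where $|\sigma|$ is the set of $\alpha$ with support in $\sigma$, topologized as a standard simplex. Vietoris metric thickening: $\mathcal{V}^m(\mathscr{U})$ is the set of finitely supported probability measures $\mu$ on $X$ such that $\operatorname{supp}(\mu)\subseteq U$ for some $U\in\mathscr{U}$, with the 1-Wasserstein metric. For $\mu=\sum_i a_i\delta_{x_i}$, $\nu=\sum_j b_j\delta_{y_j}$ (finite sums of weighted Dirac measures), $d_W(\mu,\nu)=\inf\sum_{i,j}\gamma_{i,j}d_X(x_i,y_j)$,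 the infimum being over all $\gamma_{i,j}\ge0$ with $\sum_i\gamma_{i,j}=b_j$ for all $j$ and $\sum_j\gamma_{i,j}=a_i$ for all $i$. The natural bijection sends $\alpha$ to the measure $\sum_{x\in X}\alpha(x)\delta_x$. *)

(* Defs.v *)
From HB Require Import structures.
From mathcomp Require Import all_boot all_order all_algebra finmap.
From mathcomp Require Import all_classical all_reals all_analysis.
From mathcomp Require Import lra.

Set Implicit Arguments.
Unset Strict Implicit.
Unset Printing Implicit Defensive.

Import Order.TTheory GRing.Theory Num.Theory.
Import numFieldNormedType.Exports.

Local Open Scope classical_set_scope.
Local Open Scope ring_scope.

Section Covers.
Context {R : realType} {X : metricType R}.
Implicit Types (A : set X) (U : set (set X)).

(* Under this convention the diameter of the empty set is -oo. *)
Definition diam A : \bar R :=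
  ereal_sup [set (mdist x y)%:E | x in A & y in A].

Definition open_cover U : Prop :=
  (forall V, U V -> open V) /\ \bigcup_(V in U) V = setT.

Definition uniformly_bounded U : Prop :=
  exists D : R, forall V, U V -> (diam V <= D%:E)%E.

Definition vietoris U : set (set X) :=
  [set s | finite_set s /\ exists2 V, U V & s `<=` V].

End Covers.

Section Realization.
Context {R : realType} {X : metricType R}.
Implicit Types U : set (set X).

Definition supp (a : X -> R) : set X := [set x | a x != 0].

Record realization U := Realization {
  coord :> X -> R ;
  coord_itv : forall x, 0 <= coord x <= 1 ;
  coord_simplex : vietoris U (supp coord) ;
  coord_sum : \sum_(x \in [set: X]) coord x = 1 }.

HB.instance Definition _ U := gen_eqMixin (realization U).
HB.instance Definition _ U := gen_choiceMixin (realization U).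

Definition closed_simplex U (s : set X) : set (realization U) :=
  [set a | supp a `<=` s].

(* The topology of |s| is that of a standard simplex, given here by the sup
   norm on R^s. *)
Definition open_in_simplex U (s : set X) (W : set (realization U)) : Prop :=
  forall a, closed_simplex s a -> W a ->
    exists2 e : R, 0 < e & forall b, closed_simplex s b ->
      (forall x, s x -> `|a x - b x| < e) -> W b.

Definition weak_open U : set_system (realization U) :=
  [set W | forall s, vietoris U s -> open_in_simplex s W].

Lemma weak_openT U : @weak_open U setT.
Proof. by move=> s _ a _ _; exists 1. Qed.

Lemma weak_openI U : setI_closed (@weak_open U).
Proof.
move=> A B oA oB s Us a sa [Aa Ba].
have [e e0 eA] := oA _ Us _ sa Aa; have [d d0 dB] := oB _ Us _ sa Ba.
exists (Num.min e d) => [|b sb ab]; first by rewrite lt_min e0.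
by split; [apply: eA|apply: dB] => // x sx; have := ab _ sx;
  rewrite lt_min => /andP[].
Qed.

Lemma weak_open_bigU U (I : Type) (f : I -> set (realization U)) :
  (forall i, weak_open (f i)) -> weak_open (\bigcup_i f i).
Proof.
move=> of_ s Us a sa [i _ fia].
have [e e0 ef] := of_ i _ Us _ sa fia.
by exists e => // b sb ab; exists i => //; exact: ef.
Qed.

HB.instance Definition _ U := isOpenTopological.Build (realization U)
  (@weak_openT U) (@weak_openI U) (@weak_open_bigU U).

End Realization.

Section Measures.
Context {R : realType} {X : metricType R}.
Implicit Types (w : X -> R) (mu nu : set X -> R) (U : set (set X)).

Definition dirac_mass (x : X) : set X -> R := fun A => \1_A x.

Definition dirac_sum w : set X -> R :=
  fun A => \sum_(x \in [set: X]) w x * dirac_mass x A.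

(* Finitely supported measures are defined on every subset of X; since points
   are closed, they are determined by their values on Borel sets.  The
   library's measures are not used because they live on pointed types, while
   X may be empty. *)
Definition finsupp_probability mu : Prop :=
  exists w, [/\ finite_set (supp w), forall x, 0 <= w x,
    \sum_(x \in [set: X]) w x = 1 & mu = dirac_sum w].

Definition mass mu : X -> R := fun x => mu [set x].

Lemma mass_dirac_sum w : mass (dirac_sum w) = w.
Proof.
apply/funext => x; rewrite /mass /dirac_sum /dirac_mass.
rewrite (fsbigTE [fset x]%fset) => [|y]; last first.
  by rewrite inE => /eqP yx; rewrite indicE memNset ?mulr0.
by rewrite big_seq_fset1 indicE mem_set// mulr1.
Qed.

(* The Dirac decompositions of mu and nu are the canonical ones, indexed by the
   supports; the values of g elsewhere are irrelevant. *)
Definition coupling mu nu (g : X -> X -> R) : Prop :=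
  [/\ forall x y, 0 <= g x y,
      forall x, supp (mass mu) x ->
        \sum_(y \in supp (mass nu)) g x y = mass mu x &
      forall y, supp (mass nu) y ->
        \sum_(x \in supp (mass mu)) g x y = mass nu y].

Definition cost mu nu (g : X -> X -> R) : R :=
  \sum_(x \in supp (mass mu)) \sum_(y \in supp (mass nu)) g x y * mdist x y.

Definition wasserstein mu nu : R := inf [set cost mu nu g | g in coupling mu nu].

Record thickening U := Thickening {
  meas :> set X -> R ;
  meas_prob : finsupp_probability meas ;
  meas_supp : exists2 V, U V & supp (mass meas) `<=` V }.

HB.instance Definition _ U := gen_eqMixin (thickening U).
HB.instance Definition _ U := gen_choiceMixin (thickening U).

Lemma thickening_ext U (m n : thickening U) :
  (forall x, mass m x = mass n x) -> m = n.
Proof.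
move: m n => [m pm sm] [n pn sn] /= mn.
have E : m = n.
  case: (pm) (pn) mn => [w [_ _ _ ->]] [v [_ _ _ ->]].
  by rewrite !mass_dirac_sum => /funext ->.
by move: E pm sm pn sn {mn} => <- *; congr Thickening; exact: Prop_irrelevance.
Qed.

Lemma finsupp_massP mu : finsupp_probability mu ->
  [/\ finite_set (supp (mass mu)), forall x, 0 <= mass mu x &
      \sum_(x \in supp (mass mu)) mass mu x = 1].
Proof.
move=> [w [fw w0 w1 ->]]; rewrite mass_dirac_sum; split => //.
rewrite -w1; apply: fsbig_widen => // x [_]/=.
by rewrite /supp/= => /negP; rewrite negbK => /eqP.
Qed.

Lemma cost_ge0 mu nu g : coupling mu nu g -> 0 <= cost mu nu g.
Proof.
move=> [g0 _ _]; apply: fsumr_ge0 => x _; apply: fsumr_ge0 => y _.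
by rewrite mulr_ge0// mdist_ge0.
Qed.

Lemma coupling_prod mu nu : finsupp_probability mu -> finsupp_probability nu ->
  coupling mu nu (fun x y => mass mu x * mass nu y).
Proof.
move=> /finsupp_massP[_ m0 m1] /finsupp_massP[_ n0 n1]; split.
- by move=> x y; rewrite mulr_ge0.
- by move=> x _; rewrite -mulr_fsumr n1 mulr1.
- by move=> y _; rewrite -mulr_fsuml m1 mul1r.
Qed.

Lemma exchange_fsum (A B : set X) (F : X -> X -> R) :
  finite_set A -> finite_set B ->
  \sum_(x \in A) \sum_(y \in B) F x y = \sum_(y \in B) \sum_(x \in A) F x y.
Proof.
move=> fA fB; under eq_fsbigr do rewrite fsbig_finite//.
rewrite fsbig_finite// exchange_big/= fsbig_finite//.
by apply: eq_bigr => y _; rewrite fsbig_finite.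
Qed.

Lemma ler_fsumr (A : set X) (F G : X -> R) : finite_set A ->
  (forall x, A x -> F x <= G x) ->
  \sum_(x \in A) F x <= \sum_(x \in A) G x.
Proof.
move=> fA FG; rewrite !fsbig_finite//= big_seq [leRHS]big_seq.
by apply: ler_sum => x; rewrite in_fset_set// inE => /FG.
Qed.

Lemma coupling_sym mu nu g : coupling mu nu g -> coupling nu mu (fun x y => g y x).
Proof. by move=> [g0 g1 g2]; split. Qed.

Lemma cost_sym mu nu g : finsupp_probability mu -> finsupp_probability nu ->
  cost nu mu (fun x y => g y x) = cost mu nu g.
Proof.
move=> /finsupp_massP[fm _ _] /finsupp_massP[fn _ _].
rewrite /cost exchange_fsum//.
by apply: eq_fsbigr => x _; apply: eq_fsbigr => y _; rewrite metric_sym.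
Qed.

Lemma wasserstein_sym mu nu : finsupp_probability mu ->
  finsupp_probability nu -> wasserstein mu nu = wasserstein nu mu.
Proof.
move=> pm pn; rewrite /wasserstein; congr inf; apply/seteqP; split => _ [g cg <-].
  by exists (fun x y => g y x); [exact: coupling_sym|rewrite cost_sym].
by exists (fun x y => g y x); [exact: coupling_sym|rewrite cost_sym].
Qed.

Lemma wasserstein_le mu nu g : coupling mu nu g -> wasserstein mu nu <= cost mu nu g.
Proof.
by move=> cg; apply: ge_inf; [exists 0 => _ [h ch <-]; exact: cost_ge0|exists g].
Qed.

Lemma wasserstein_lt mu nu e : finsupp_probability mu ->
  finsupp_probability nu -> 0 < e ->
  exists2 g, coupling mu nu g & cost mu nu g < wasserstein mu nu + e.
Proof.
move=> pm pn e0.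
have [] := @inf_adherent _ [set cost mu nu g | g in coupling mu nu] _ e0.
  split; last by exists 0 => _ [h ch <-]; exact: cost_ge0.
  by eexists; eexists; [exact: coupling_prod|reflexivity].
by move=> _ [g cg <-] ge; exists g.
Qed.

Lemma wasserstein_xx mu : finsupp_probability mu -> wasserstein mu mu = 0.
Proof.
move=> pm; have [fm m0 m1] := finsupp_massP pm.
have D (h : X -> X -> R) z : supp (mass mu) z -> 
    \sum_(y \in supp (mass mu)) mass mu z * (z == y)%:R * h z y = mass mu z * h z z.
  move=> sz; rewrite (fsbigD1 z)//= eqxx mulr1 fsbig1 ?addr0// => y [_ /= /eqP].
  by rewrite eq_sym => /negbTE ->; rewrite mulr0 mul0r.
apply/eqP; rewrite eq_le; apply/andP; split; last first.
  apply: lb_le_inf; last by move=> _ [h ch <-]; exact: cost_ge0.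
  by eexists; eexists; [exact: coupling_prod|reflexivity].
have cg : coupling mu mu (fun x y => mass mu x * (x == y)%:R).
  split=> [x y|x sx|y sy]; first by rewrite mulr_ge0.
    by have := D (fun _ _ => 1) x sx; under eq_fsbigr do rewrite mulr1; rewrite mulr1.
  have := D (fun _ _ => 1) y sy; under eq_fsbigr do rewrite mulr1.
  rewrite mulr1 => E; rewrite -[RHS]E; apply: eq_fsbigr => x _.
  by case: eqVneq => [->|xy]; rewrite ?mulr0.
apply: (le_trans (wasserstein_le cg)).
rewrite /cost fsbig1// => x sx.
by rewrite (D (fun x y => mdist x y))// mdistxx mulr0.
Qed.

Lemma wasserstein_triangle nu mu la : finsupp_probability mu ->
  finsupp_probability nu -> finsupp_probability la ->
  wasserstein mu la <= wasserstein mu nu + wasserstein nu la.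
Proof.
move=> pm pn pl; apply/ler_addgt0Pl => e e0.
have e20 : 0 < e / 2 by rewrite divr_gt0.
have [g cg ge] := wasserstein_lt pm pn e20.
have [h ch he] := wasserstein_lt pn pl e20.
have [fm m0 m1] := finsupp_massP pm.
have [fn n0 n1] := finsupp_massP pn.
have [fl l0 l1] := finsupp_massP pl.
case: (cg) => g0 gm gn; case: (ch) => h0 hn hl.
set S := supp (mass mu) in gm gn fm m1 *.
set T := supp (mass nu) in gm gn hn hl fn n1 *.
set V := supp (mass la) in hn hl fl l1 *.
pose k x z := \sum_(y \in T) g x y * h y z / mass nu y.
have ck : coupling mu la k.
  split=> [x z|x sx|z sz].
  - by apply: fsumr_ge0 => y _; rewrite divr_ge0// mulr_ge0.
  - rewrite exchange_fsum// -gm//; apply: eq_fsbigr => y; rewrite inE => Ty.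
    under eq_fsbigr do rewrite mulrAC.
    by rewrite -mulr_fsumr hn// divfK.
  - rewrite exchange_fsum// -hl//; apply: eq_fsbigr => y; rewrite inE => Ty.
    under eq_fsbigr do rewrite -mulrA.
    by rewrite -mulr_fsuml gn// mulrC divfK.
have {}ck := wasserstein_le ck.
suff : cost mu la k <= cost mu nu g + cost nu la h by lra.
rewrite /cost -/S -/T -/V.
have -> : \sum_(x \in S) \sum_(y \in T) g x y * mdist x y =
    \sum_(x \in S) \sum_(z \in V) \sum_(y \in T)
      g x y * h y z / mass nu y * mdist x y.
  apply: eq_fsbigr => x _; rewrite exchange_fsum//.
  apply: eq_fsbigr => y; rewrite inE => Ty.
  rewrite -mulr_fsuml; congr (_ * _).
  under eq_fsbigr do rewrite mulrAC.
  by rewrite -mulr_fsumr hn// divfK.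
have -> : \sum_(y \in T) \sum_(z \in V) h y z * mdist y z =
    \sum_(x \in S) \sum_(z \in V) \sum_(y \in T)
      g x y * h y z / mass nu y * mdist y z.
  rewrite [RHS]exchange_fsum// [LHS]exchange_fsum//; apply: eq_fsbigr => z _.
  rewrite exchange_fsum//; apply: eq_fsbigr => y; rewrite inE => Ty.
  rewrite -mulr_fsuml; congr (_ * _).
  under eq_fsbigr do rewrite -mulrA.
  by rewrite -mulr_fsuml gn// mulrC divfK.
rewrite -fsbig_split//; apply: ler_fsumr => // x _ /=.
rewrite -fsbig_split//; apply: ler_fsumr => // z _ /=.
rewrite -fsbig_split// mulr_fsuml; apply: ler_fsumr => // y _ /=.
by rewrite -mulrDr ler_wpM2l ?metric_triangle// divr_ge0// mulr_ge0.
Qed.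

Lemma finite_separation (A : set X) x : finite_set A ->
  exists2 r : R, 0 < r & forall y, A y -> y != x -> r <= mdist x y.
Proof.
move=> fA; pose s := [seq y <- fset_set A | y != x].
have [r r0 H] : exists2 r : R, 0 < r & forall y, y \in s -> r <= mdist x y.
  have : forall y, y \in s -> y != x by move=> y; rewrite mem_filter => /andP[].
  elim: s => [_|y s IH H]; first by exists 1.
  have [|r r0 rH] := IH; first by move=> z zs; apply: H; rewrite inE zs orbT.
  exists (Num.min r (mdist x y)).
    by rewrite lt_min r0 mdist_gt0 eq_sym H// mem_head.
  move=> z; rewrite inE => /orP[/eqP ->|/rH zr]; first by rewrite ge_min lexx orbT.
  by rewrite ge_min zr.
exists r => // y Ay yx; apply: H; rewrite mem_filter yx/= in_fset_set//.
exact: mem_set.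
Qed.

Lemma wasserstein_eq0_le mu nu x : finsupp_probability mu ->
  finsupp_probability nu -> wasserstein mu nu = 0 -> mass mu x <= mass nu x.
Proof.
move=> pm pn W0.
have [fm m0 m1] := finsupp_massP pm; have [fn n0 n1] := finsupp_massP pn.
have [->//|mx] := eqVneq (mass mu x) 0.
have [r r0 rH] := finite_separation x fn.
apply/ler_addgt0Pl => e e0.
have [g cg] := wasserstein_lt pm pn (mulr_gt0 e0 r0).
rewrite W0 add0r => ge; case: (cg) => g0 gm gn.
have D1 : ~ supp (mass nu) x -> supp (mass nu) `\ x = supp (mass nu).
  by move=> nx; apply: setDidl; apply/seteqP; split => // y [ny /= yx];
    apply: nx; rewrite -yx.
have H : r * \sum_(y \in supp (mass nu) `\ x) g x y <= cost mu nu g.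
  rewrite /cost [leRHS](fsbigD1 x)//= -[leLHS]addr0; apply: lerD; last first.
    by apply: fsumr_ge0 => z _; apply: fsumr_ge0 => y _; rewrite mulr_ge0// mdist_ge0.
  apply: (@le_trans _ _ (\sum_(y \in supp (mass nu) `\ x) g x y * mdist x y)).
    rewrite mulr_fsumr; apply: ler_fsumr; first exact: finite_setD.
    by move=> y [ny /eqP yx]; rewrite mulrC ler_wpM2l// rH.
  have [nx|nx] := pselect (supp (mass nu) x).
    by rewrite [leRHS](fsbigD1 x)//= mdistxx mulr0 add0r.
  by rewrite D1.
have {}H : \sum_(y \in supp (mass nu) `\ x) g x y < e.
  by rewrite -(ltr_pM2l r0) (le_lt_trans H)// mulrC.
rewrite -gm//; have [nx|nx] := pselect (supp (mass nu) x).
  rewrite (fsbigD1 x)//= addrC; apply: lerD; first exact: ltW.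
  by rewrite -gn// (fsbigD1 x)//= lerDl; exact: fsumr_ge0.
rewrite -[leLHS]addr0 lerD// ltW//.
by move: H; rewrite D1.
Qed.

Section ThickeningMetric.
Context (U : set (set X)).
Implicit Types m n p : thickening U.

Definition thickening_dist m n : R := wasserstein m n.

Lemma thickening_distxx m : thickening_dist m m = 0.
Proof. exact/wasserstein_xx/meas_prob. Qed.

Lemma thickening_dist_positivity m n : thickening_dist m n = 0 -> m = n.
Proof.
move=> mn; apply: thickening_ext => x; apply/eqP; rewrite eq_le.
have [pm pn] := (meas_prob m, meas_prob n).
by rewrite !wasserstein_eq0_le// wasserstein_sym.
Qed.

Lemma thickening_dist_sym m n : thickening_dist m n = thickening_dist n m.
Proof. by apply: wasserstein_sym; exact: meas_prob. Qed.

Lemma thickening_dist_triangle n m p :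
  thickening_dist m p <= thickening_dist m n + thickening_dist n p.
Proof. by apply: wasserstein_triangle; exact: meas_prob. Qed.

HB.instance Definition _ := isMetric.Build R (thickening U)
  thickening_distxx thickening_dist_positivity thickening_dist_sym
  thickening_dist_triangle.

End ThickeningMetric.

Lemma dirac_sum_prob U (a : realization U) : finsupp_probability (dirac_sum a).
Proof.
exists a; split => //; first by have [] := coord_simplex a.
- by move=> x; have /andP[] := coord_itv a x.
- exact: coord_sum.
Qed.

Lemma dirac_sum_supp U (a : realization U) :
  exists2 V, U V & supp (mass (dirac_sum a)) `<=` V.
Proof. by rewrite mass_dirac_sum; have [] := coord_simplex a. Qed.

Definition natural_map U (a : realization U) : thickening U :=
  Thickening (dirac_sum_prob a) (dirac_sum_supp a).

Lemma natural_map_bij U : bijective (@natural_map U).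
Proof.
rewrite -setTT_bijective; split => //.
  move=> [a ai as_ a1] [b bi bs b1] _ _ /(congr1 (fun m : thickening U => mass m)).
  rewrite /= !mass_dirac_sum => ab.
  move: ab ai as_ a1 bi bs b1 => <- *.
  by congr Realization; exact: Prop_irrelevance.
move=> m _; have [w [fw w0 w1 mw]] := meas_prob m.
have [V UV mV] := meas_supp m.
have wi x : 0 <= w x <= 1.
  have <- : \sum_(y \in supp w) w y = 1.
    rewrite -w1; apply: fsbig_widen => // y [_ /= /negP].
    by rewrite negbK => /eqP.
  rewrite w0/=.
  have [->|wx] := eqVneq (w x) 0; first exact: fsumr_ge0.
  by rewrite (fsbigD1 x)//= lerDl fsumr_ge0.
have ws : vietoris U (supp w).
  by split => //; exists V => //; move: mV; rewrite mw mass_dirac_sum.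
exists (Realization wi ws w1) => //; apply: thickening_ext => x /=.
by rewrite mw.
Qed.

End Measures.

Section Homotopy.
Context (R : realType).

Definition cube n : set 'rV[R]_n := [set t | forall i, 0 <= t ord0 i <= 1].

Definition cube_boundary n : set 'rV[R]_n :=
  [set t | cube t /\ exists i, t ord0 i = 0 \/ t ord0 i = 1].

Section Space.
Context {T : topologicalType}.

Definition joined (x y : T) : Prop := exists p : R -> T,
  [/\ {within `[0, 1], continuous p}, p 0 = x & p 1 = y].

Definition pi0 : set (set T) := range (fun x => [set y | joined x y]).

(* The values of a cubical loop outside the cube are irrelevant, and homotopic
   identifies functions that agree on the cube. *)
Definition cubical_loop n (x0 : T) : set ('rV[R]_n -> T) :=
  [set u | {within @cube n, continuous u} /\
           forall t, cube_boundary t -> u t = x0].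

Definition homotopic n (x0 : T) (u v : 'rV[R]_n -> T) : Prop :=
  exists H : R * 'rV[R]_n -> T,
    [/\ {within `[0, 1] `*` @cube n, continuous H},
        forall t, cube t -> H (0, t) = u t,
        forall t, cube t -> H (1, t) = v t &
        forall (s : R) t, 0 <= s <= 1 -> cube_boundary t -> H (s, t) = x0].

Definition homotopy_class n (x0 : T) (u : 'rV[R]_n -> T) :
    set ('rV[R]_n -> T) :=
  [set v | cubical_loop x0 v /\ homotopic x0 u v].

(* Elements are the homotopy classes themselves, relative to the boundary. *)
Definition homotopy_group n (x0 : T) : set (set ('rV[R]_n -> T)) :=
  [set homotopy_class x0 u | u in @cubical_loop n x0].

Definition set_coord0 n (t : 'rV[R]_n.+1) (s : R) : 'rV[R]_n.+1 :=
  \row_j (if j == ord0 then s else t ord0 j).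

Definition loop_concat n (u v : 'rV[R]_n.+1 -> T) : 'rV[R]_n.+1 -> T :=
  fun t => if t ord0 ord0 <= 2^-1 then u (set_coord0 t (2 * t ord0 ord0))
           else v (set_coord0 t (2 * t ord0 ord0 - 1)).

Definition homotopy_mul n (x0 : T) (C D : set ('rV[R]_n.+1 -> T)) :
    set ('rV[R]_n.+1 -> T) :=
  \bigcup_(u in C) \bigcup_(v in D) homotopy_class x0 (loop_concat u v).

End Space.

Section Map.
Context {S T : topologicalType} (f : S -> T).

Definition pi0_map (C : set S) : set T :=
  \bigcup_(x in C) [set y | joined (f x) y].

Definition homotopy_map n (x0 : S) (C : set ('rV[R]_n -> S)) :
    set ('rV[R]_n -> T) :=
  \bigcup_(u in C) homotopy_class (f x0) (f \o u).

(* The second clause says that f induces group isomorphisms on all homotopy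
   groups of positive degree, at all base points. *)
Definition weak_homotopy_equivalence : Prop :=
  [/\ continuous f,
      set_bij pi0 pi0 pi0_map &
      forall (n : nat) (x0 : S),
        set_bij (homotopy_group x0) (homotopy_group (f x0))
          (@homotopy_map n.+1 x0) /\
        {in homotopy_group x0 &, {morph @homotopy_map n.+1 x0 :
          C D / homotopy_mul x0 C D >-> homotopy_mul (f x0) C D}}].

End Map.
End Homotopy.

(* Main.v *)
Require Import Defs.
From mathcomp Require Import all_boot all_order all_algebra finmap.
From mathcomp Require Import all_classical all_reals all_analysis.
From mathcomp Require Import lra ring zify.

(** Both spaces consist of the same measures, and the natural map is continuous
because on a simplex the Wasserstein distance is at most a multiple of the l1
distance of the coordinates.  What has to be shown is that a cube in the
thickening can be deformed into one that is continuous for the weak topology.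

On the source, continuity of a family of measures for the weak topology is the
following property, called tameness: locally all supports lie in one finite set
and all coordinates are continuous ([tame_continuous], [continuous_tame]).  The
point is that a continuous family in the thickening may carry small masses that
move through infinitely many points of [X]; the deformation must remove them.

Locally this is easy ([exists_contraction]).  Let [c] have its support in the
open set [V] of the cover, and let [phi] be a Lipschitz function that is 1 on
the support of [c] and 0 outside [V].  A measure [m] close to [c] has most of
its mass near the support of [c].  Move [m] linearly to its restriction
[phi m / int phi dm], which adds no points to the support, and then to [c];
the second segment is allowed because both ends have their supports in [V].
Since balls of the Wasserstein metric are convex, a small ball around [c] is
contracted inside a given ball.  The bound on the diameters makes the
restriction continuous: removing a small mass at a bounded distance is cheap.
The formula defining the contraction clearly preserves tameness.

Globally, a map [u] from a cube to the thickening is changed on the cells of a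
fine grid, one after the other: on the cell with bump function [b], the map [u]
is replaced by [t |-> h (b t) (u t)], where [h] contracts a ball that contains
the values on the cell.  This makes the map constant, hence tame, where [b = 1],
and it is tame at all points where it was tame before ([move_cell_tame],
[move_cell_tame1]).  The grid cells fall into [2 ^ N] parity classes, and cells
of the same class are disjoint.  As this number of classes does not depend on
the mesh, the radii of the contracted balls can be chosen backwards so that the
moves of one class do not lead out of the balls used for the next one
([move_parity_classes]).  Multiplying the bump functions by a function that
vanishes on the boundary gives a deformation relative to the boundary, provided
that the map is tame near the boundary ([tame_approximation]).

Applied to a loop made constant near the boundary, this shows that the map on
homotopy groups is surjective ([loop_tame_approximation]).  Applied to a
homotopy in the thickening between two loops of the realization, made constant
near the faces of a cube of one more dimension, it shows injectivity
([natural_map_homotopic_inj]); dimension 0 is the statement on path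
components. *)

Set Implicit Arguments.
Unset Strict Implicit.
Unset Printing Implicit Defensive.

Import Order.TTheory GRing.Theory Num.Theory.
Import numFieldNormedType.Exports.

Local Open Scope classical_set_scope.
Local Open Scope ring_scope.

(** * Continuity and neighbourhoods *)

Section FiniteUniform.
Context {R : realType} {I : choiceType}.

Lemma fset_uniform_pos (F : {fset I}) (P : I -> R -> Prop) :
  (forall y, y \in F -> exists2 e, 0 < e & P y e) ->
  (forall y e e', 0 < e' <= e -> P y e -> P y e') ->
  exists2 e, 0 < e & forall y, y \in F -> P y e.
Proof.
move=> PF Pm.
have {}PF y : y \in enum_fset F -> exists2 e, 0 < e & P y e by exact: PF.
suff : exists2 e, 0 < e & forall y, y \in enum_fset F -> P y e by [].
elim: (enum_fset F) PF => [_|x s IH PF]; first by exists 1.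
have [|e e0 Pe] := IH; first by move=> y ys; apply: PF; rewrite inE ys orbT.
have [|d d0 Pd] := PF x; first exact: mem_head.
have m0 : 0 < Num.min e d by rewrite lt_min e0.
exists (Num.min e d) => // y; rewrite inE => /orP[/eqP ->|/Pe].
  by apply: Pm Pd; rewrite m0 ge_min lexx orbT.
by apply: Pm; rewrite m0 ge_min lexx.
Qed.

Lemma near_fset {T : Type} (Fi : set_system T) (F : {fset I}) (P : T -> I -> Prop) :
  Filter Fi -> (forall y, y \in F -> \forall t \near Fi, P t y) ->
  \forall t \near Fi, forall y, y \in F -> P t y.
Proof.
move=> FF PF.
have := filter_bigI (f := fun y => [set t | P t y]) FF PF.
by apply: filterS => t /= H y yF; exact: H.
Qed.

End FiniteUniform.

Lemma real_continuousP {R : realType} {Y : topologicalType} (f : Y -> R) t :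
  {for t, continuous f} <->
  forall e, 0 < e -> \forall t' \near t, `|f t - f t'| < e.
Proof. exact: cvgrPdist_lt. Qed.

Lemma near_gt0 {R : realType} {Y : topologicalType} (f : Y -> R) t :
  {for t, continuous f} -> 0 < f t -> \forall t' \near t, 0 < f t'.
Proof. by move=> cf; exact: cvgr_gt. Qed.

Lemma near_lt {R : realType} {Y : topologicalType} (f : Y -> R) t c :
  continuous f -> f t < c -> \forall t' \near t, f t' < c.
Proof. by move=> cf; apply: cvgr_lt; exact: cf. Qed.

Lemma near_ord {Y : topologicalType} n (t : Y) (P : Y -> 'I_n -> Prop) :
  (forall i, \forall t' \near t, P t' i) -> \forall t' \near t, forall i, P t' i.
Proof.
move=> nP.
have : \forall t' \near t, forall i, i \in [fset i | i in 'I_n]%fset -> P t' i.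
  by apply: near_fset => i _; exact: nP.
by apply: filterS => t' H i; apply: H; rewrite !inE.
Qed.

Lemma continuous_pairing {Y S T : topologicalType} (f : Y -> S) (g : Y -> T) :
  continuous f -> continuous g -> continuous (fun y => (f y, g y)).
Proof. by move=> cf cg y; exact: (cvg_pair (cf y) (cg y)). Qed.

Lemma continuous_composite {Y S T : topologicalType} (f : Y -> S) (g : S -> T) :
  continuous f -> continuous g -> continuous (g \o f).
Proof. by move=> cf cg y; apply: continuous_comp; [exact: cf|exact: cg]. Qed.

Lemma continuous_slice {Y S : topologicalType} (s : S) :
  continuous (fun y : Y => (s, y)).
Proof.
by apply: continuous_pairing => y; [exact: cvg_cst|exact: cvg_id].
Qed.

Section Pasting.
Context {R : realType} {Z T : topologicalType}.

Lemma continuous_paste (a : Z -> R) (c : R) (f g : Z -> T) :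
  continuous a -> continuous f -> continuous g ->
  (forall z, a z = c -> f z = g z) ->
  continuous (fun z => if a z <= c then f z else g z).
Proof.
move=> ca cf cg fg z.
have [ac|ac|ac] := ltgtP (a z) c.
- rewrite /continuous_at ifT ?(ltW ac)//.
  apply: (@cvg_trans _ (f @ z)); last exact: cf.
  apply: near_eq_cvg; near=> z'; rewrite ifT// ltW//.
  by near: z'; exact: cvgr_lt (ca z) _ ac.
- rewrite /continuous_at ifF; last by apply/negbTE; rewrite -ltNge.
  apply: (@cvg_trans _ (g @ z)); last exact: cg.
  apply: near_eq_cvg; near=> z'; rewrite ifF//; apply/negbTE; rewrite -ltNge.
  by near: z'; exact: cvgr_gt (ca z) _ ac.
- rewrite /continuous_at ac lexx => W Wf.
  have Wg : nbhs (g z) W by rewrite -(fg _ ac).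
  have nf : \forall z' \near z, W (f z') by exact: cf Wf.
  have ng : \forall z' \near z, W (g z') by exact: cg Wg.
  by apply: filterS2 nf ng => z' ? ? /=; case: ifP.
Unshelve. all: by end_near. Qed.

End Pasting.

Section Clamp.
Context {R : realType}.
Implicit Types x y : R.

Definition clamp x : R := Num.max 0 (Num.min 1 x).

Lemma clamp_itv x : 0 <= clamp x <= 1.
Proof. by rewrite /clamp le_max lexx/= ge_max ler01 ge_min lexx. Qed.

Lemma clamp_id x : 0 <= x <= 1 -> clamp x = x.
Proof. by rewrite /clamp => /andP[x0 x1]; rewrite (min_idPr x1) (max_idPr x0). Qed.

Lemma clamp_le0 x : x <= 0 -> clamp x = 0.
Proof. by move=> x0; apply/max_idPl; rewrite ge_min x0 orbT. Qed.

Lemma clamp_ge1 x : 1 <= x -> clamp x = 1.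
Proof. by move=> x1; rewrite /clamp (min_idPl x1); apply/max_idPr. Qed.

Lemma clamp_cases x : [\/ x <= 0 /\ clamp x = 0, 1 <= x /\ clamp x = 1 |
  0 <= x <= 1 /\ clamp x = x].
Proof.
have [x0|x0] := leP x 0; first by constructor 1; rewrite clamp_le0.
have [x1|x1] := leP 1 x; first by constructor 2; rewrite clamp_ge1.
by constructor 3; rewrite clamp_id ?ltW.
Qed.

Lemma clamp_lipschitz x y : `|clamp x - clamp y| <= `|x - y|.
Proof.
rewrite ler_norml.
by case: (clamp_cases x) => -[] + ->; case: (clamp_cases y) => -[] + ->;
  case: (ler0P (x - y)); lra.
Qed.

Lemma continuous_clamp : continuous clamp.
Proof.
move=> x; apply/cvgrPdist_lt => e e0; near=> y.
apply: le_lt_trans (clamp_lipschitz _ _) _; near: y.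
exact: (cvgr_dist_lt _ _ (@cvg_id _ (nbhs x))).
Unshelve. all: by end_near. Qed.

End Clamp.

(** * Transport plans on a finite set *)

Section Plans.
Context {R : realType} {X : metricType R}.
Implicit Types (F : {fset X}) (w v : X -> R) (g : X -> X -> R).

Definition weights F w : Prop :=
  [/\ forall x, 0 <= w x, forall x, x \notin F -> w x = 0 &
      \sum_(x <- F) w x = 1].

(** A [coupling] is constrained on the supports of its two marginals only.  Plans
live on a finite set that contains all supports in question, so plans between
different measures can be added, and the marginals need not have mass 1. *)
Definition plan F w v g : Prop :=
  [/\ forall x y, 0 <= g x y,
      forall x, x \in F -> \sum_(y <- F) g x y = w x &
      forall y, y \in F -> \sum_(x <- F) g x y = v y].

Definition plan_cost F g : R := \sum_(x <- F) \sum_(y <- F) g x y * mdist x y.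

Definition wdist w v : R := wasserstein (dirac_sum w) (dirac_sum v).

Lemma fsum_fset F (A : set X) (f : X -> R) : A `<=` [set` F] ->
  (forall x, x \in F -> ~ A x -> f x = 0) ->
  \sum_(x \in A) f x = \sum_(x <- F) f x.
Proof.
move=> AF f0; apply: fsbig_fwiden => //.
by move=> x [/= xF nA]; exact: f0.
Qed.

Lemma weights_sumT F w : weights F w -> \sum_(x \in [set: X]) w x = 1.
Proof. by move=> [_ w0 <-]; exact: fsbigTE. Qed.

Lemma weights_supp F w : weights F w -> supp w `<=` [set` F].
Proof. by move=> [_ w0 _] x /= /negP; apply: contra_notT => /w0 ->. Qed.

Lemma weights_prob F w : weights F w -> finsupp_probability (dirac_sum w).
Proof.
move=> Fw; exists w; split => //; last exact: weights_sumT Fw.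
  exact: sub_finite_set (weights_supp Fw) (finite_fset _).
by have [] := Fw.
Qed.

Lemma weightsW F G w : {subset F <= G} -> weights F w -> weights G w.
Proof.
move=> FG [w0 wF w1]; split=> // [x|].
  by move=> xG; apply: wF; apply: contra xG => /FG.
rewrite -w1; apply/esym/big_fset_incl; first exact/fsubsetP.
by move=> x _ /wF.
Qed.

Lemma wdist_le_plan F w v g : weights F w -> weights F v -> plan F w v g ->
  wdist w v <= plan_cost F g.
Proof.
move=> Fw Fv [g0 gw gv].
have [sw sv] := (weights_supp Fw, weights_supp Fv).
have gx x y : x \in F -> y \in F -> ~ supp w x -> g x y = 0.
  move=> xF yF /negP; rewrite negbK => /eqP wx0.
  have /eqP := gw _ xF; rewrite wx0 psumr_eq0; last by move=> *; exact: g0.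
  by move=> /allP/(_ _ yF)/implyP/(_ isT)/eqP.
have gy x y : x \in F -> y \in F -> ~ supp v y -> g x y = 0.
  move=> xF yF /negP; rewrite negbK => /eqP vy0.
  have /eqP := gv _ yF; rewrite vy0 psumr_eq0; last by move=> *; exact: g0.
  by move=> /allP/(_ _ xF)/implyP/(_ isT)/eqP.
have cg : coupling (dirac_sum w) (dirac_sum v) g.
  split => //; rewrite !mass_dirac_sum => z zs; rewrite (fsum_fset (F := F))//.
  - by apply: gw; exact: sw.
  - by move=> y yF; apply: gy => //; exact: sw.
  - by apply: gv; exact: sv.
  - by move=> x xF; apply: gx => //; exact: sv.
apply: (le_trans (wasserstein_le cg)).
rewrite /cost !mass_dirac_sum (fsum_fset (F := F))//.
  rewrite /plan_cost big_seq [leRHS]big_seq; apply: ler_sum => x xF.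
  rewrite (fsum_fset (F := F))// => y yF ny; first by rewrite gy// mul0r.
move=> x xF nx; rewrite fsbig1// => y /sv yF; first by rewrite gx// mul0r.
Qed.

Lemma plan_exists F w v c : weights F w -> weights F v -> wdist w v < c ->
  exists2 g, plan F w v g & plan_cost F g < c.
Proof.
move=> Fw Fv Wc.
have [|g [g0 gw gv] gc] := @wasserstein_lt _ _ _ _ (c - wdist w v)
    (weights_prob Fw) (weights_prob Fv).
  by rewrite subr_gt0.
have [sw sv] := (weights_supp Fw, weights_supp Fv).
rewrite addrC subrK in gc; rewrite !mass_dirac_sum in gw gv.
pose h x y := if (w x != 0) && (v y != 0) then g x y else 0.
have hE x y : supp w x -> supp v y -> h x y = g x y.
  by rewrite /supp/= /h => -> ->.
have hw x : x \in F -> \sum_(y <- F) h x y = w x.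
  move=> xF; have [wx|wx] := eqVneq (w x) 0.
    by rewrite wx big1// => y _; rewrite /h wx eqxx.
  rewrite -(fsum_fset (A := supp v))//.
    by rewrite -gw//; apply: eq_fsbigr => y; rewrite inE => sy; exact: hE.
  by move=> y _ /negP; rewrite /h negbK => /eqP ->; rewrite eqxx andbF.
have hv y : y \in F -> \sum_(x <- F) h x y = v y.
  move=> yF; have [vy|vy] := eqVneq (v y) 0.
    by rewrite vy big1// => x _; rewrite /h vy eqxx andbF.
  rewrite -(fsum_fset (A := supp w))//.
    by rewrite -gv//; apply: eq_fsbigr => x; rewrite inE => sx; exact: hE.
  by move=> x _ /negP; rewrite /h negbK => /eqP ->; rewrite eqxx.
exists h; first by split=> // x y; rewrite /h; case: ifP.
apply: le_lt_trans gc; rewrite /cost !mass_dirac_sum le_eqVlt; apply/orP; left.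
apply/eqP; rewrite /plan_cost -(fsum_fset (A := supp w))//.
  apply: eq_fsbigr => x; rewrite inE => sx.
  rewrite -(fsum_fset (A := supp v))//.
    by apply: eq_fsbigr => y; rewrite inE => sy; rewrite hE.
  by move=> y _ /negP; rewrite /h negbK => /eqP ->; rewrite eqxx andbF mul0r.
move=> x _ /negP; rewrite /h negbK => /eqP ->.
by rewrite big1// => y _; rewrite eqxx mul0r.
Qed.

Lemma wdist_ge0 F w v : weights F w -> weights F v -> 0 <= wdist w v.
Proof.
move=> Fw Fv; rewrite leNgt; apply/negP => /(plan_exists Fw Fv)[g [g0 _ _]].
rewrite ltNge => /negP; apply; apply: sumr_ge0 => x _; apply: sumr_ge0 => y _.
by rewrite mulr_ge0 ?mdist_ge0.
Qed.

(** What a partial plan leaves over can be transported in any way, at a cost of at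
most [K] per unit of mass: the product of the two remainders, divided by their
common mass, completes the plan. *)
Lemma wdist_partial_plan F w v g K : weights F w -> weights F v ->
  (forall x y, 0 <= g x y) ->
  (forall x, x \in F -> \sum_(y <- F) g x y <= w x) ->
  (forall y, y \in F -> \sum_(x <- F) g x y <= v y) ->
  (forall x y, w x != 0 -> v y != 0 -> mdist x y <= K) ->
  wdist w v <= plan_cost F g + K * (1 - \sum_(x <- F) \sum_(y <- F) g x y).
Proof.
move=> Fw Fv g0 gw gv dK; case: (Fw) => w0 wF w1; case: (Fv) => v0 vF v1.
pose r x := w x - \sum_(y <- F) g x y; pose s y := v y - \sum_(x <- F) g x y.
pose rho := 1 - \sum_(x <- F) \sum_(y <- F) g x y.
have r0 x : x \in F -> 0 <= r x by move=> xF; rewrite subr_ge0 gw.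
have s0 y : y \in F -> 0 <= s y by move=> yF; rewrite subr_ge0 gv.
have sr : \sum_(x <- F) r x = rho by rewrite sumrB w1.
have ss : \sum_(y <- F) s y = rho.
  by rewrite sumrB v1 /rho; congr (_ - _); exact: exchange_big.
have rho0 : 0 <= rho.
  by rewrite -sr big_seq; apply: sumr_ge0 => x; exact: r0.
have rE x : x \in F -> r x * rho / rho = r x.
  move=> xF; have [E|?] := eqVneq rho 0; last by rewrite mulfK.
  rewrite E mulr0 mul0r; apply/esym/eqP; rewrite eq_le r0// andbT.
  by rewrite -[leRHS]E -sr (big_fsetD1 x)//= lerDl big_seq sumr_ge0// => y;
    rewrite in_fsetD => /andP[_]; exact: r0.
have sE y : y \in F -> rho * s y / rho = s y.
  move=> yF; have [E|?] := eqVneq rho 0; last by rewrite mulrC mulKf.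
  rewrite E mul0r mul0r; apply/esym/eqP; rewrite eq_le s0// andbT.
  by rewrite -[leRHS]E -ss (big_fsetD1 y)//= lerDl big_seq sumr_ge0// => z;
    rewrite in_fsetD => /andP[_]; exact: s0.
pose h x y := g x y + (if (x \in F) && (y \in F) then r x * s y / rho else 0).
have hE x y : x \in F -> y \in F -> h x y = g x y + r x * s y / rho.
  by rewrite /h => -> ->.
have ph : plan F w v h.
  split=> [x y|x xF|y yF].
  - rewrite /h addr_ge0//; case: ifPn => // /andP[xF yF].
    by rewrite divr_ge0// mulr_ge0// ?r0// s0.
  - rewrite big_seq (eq_bigr (fun y => g x y + r x * s y / rho)); last first.
      by move=> y yF; exact: hE.
    rewrite -big_seq big_split/= -mulr_suml -mulr_sumr ss rE//.
    by rewrite /r addrC subrK.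
  - rewrite big_seq (eq_bigr (fun x => g x y + r x * s y / rho)); last first.
      by move=> x xF; exact: hE.
    rewrite -big_seq big_split/= -mulr_suml -mulr_suml sr sE//.
    by rewrite /s addrC subrK.
apply: (le_trans (wdist_le_plan Fw Fv ph)).
have -> : K * (1 - \sum_(x <- F) \sum_(y <- F) g x y) =
    \sum_(x <- F) \sum_(y <- F) K * (r x * s y / rho).
  rewrite -[X in K * X]/rho -[in LHS]sr mulr_sumr big_seq [RHS]big_seq.
  apply: eq_bigr => x xF.
  by rewrite -mulr_sumr -mulr_suml -mulr_sumr ss rE.
rewrite /plan_cost -big_split/= big_seq [leRHS]big_seq; apply: ler_sum => x xF.
rewrite -big_split/= big_seq [leRHS]big_seq; apply: ler_sum => y yF.
rewrite hE// mulrDl lerD2l mulrC.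
have [wx|wx] := eqVneq (w x) 0.
  have -> : r x = 0; last by rewrite !mul0r !mulr0.
  apply/eqP; rewrite eq_le r0// andbT /r wx sub0r oppr_le0.
  by apply: sumr_ge0.
have [vy|vy] := eqVneq (v y) 0.
  have -> : s y = 0; last by rewrite !(mulr0,mul0r).
  apply/eqP; rewrite eq_le s0// andbT /s vy sub0r oppr_le0.
  by apply: sumr_ge0.
by rewrite ler_wpM2r ?dK// divr_ge0// mulr_ge0// ?r0// s0.
Qed.

Lemma planD F w v g w' v' g' : plan F w v g -> plan F w' v' g' ->
  plan F (fun x => w x + w' x) (fun x => v x + v' x)
    (fun x y => g x y + g' x y).
Proof.
move=> [g0 gw gv] [h0 hw hv]; split=> [x y|x xF|y yF].
- by rewrite addr_ge0.
- by rewrite big_split/= gw// hw.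
- by rewrite big_split/= gv// hv.
Qed.

Lemma planZ F w v g a : 0 <= a -> plan F w v g ->
  plan F (fun x => a * w x) (fun x => a * v x) (fun x y => a * g x y).
Proof.
move=> a0 [g0 gw gv]; split=> [x y|x xF|y yF].
- by rewrite mulr_ge0.
- by rewrite -mulr_sumr gw.
- by rewrite -mulr_sumr gv.
Qed.

Lemma plan_costD F g h :
  plan_cost F (fun x y => g x y + h x y) = plan_cost F g + plan_cost F h.
Proof.
rewrite /plan_cost -big_split/=; apply: eq_bigr => x _.
by rewrite -big_split/=; apply: eq_bigr => y _; rewrite mulrDl.
Qed.

Lemma plan_costZ F g a : plan_cost F (fun x y => a * g x y) = a * plan_cost F g.
Proof.
rewrite /plan_cost mulr_sumr; apply: eq_bigr => x _.
by rewrite mulr_sumr; apply: eq_bigr => y _; rewrite mulrA.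
Qed.

Definition diagonal_plan w (x y : X) : R := if x == y then w x else 0.

Lemma sum_diagonal_planl F w x : x \in F ->
  \sum_(y <- F) diagonal_plan w x y = w x.
Proof.
move=> xF; rewrite (big_fsetD1 x)//= /diagonal_plan eqxx big_seq big1 ?addr0//.
by move=> y; rewrite in_fsetD1 eq_sym => /andP[/negbTE ->].
Qed.

Lemma sum_diagonal_planr F w y : y \in F ->
  \sum_(x <- F) diagonal_plan w x y = w y.
Proof.
move=> yF; rewrite (big_fsetD1 y)//= /diagonal_plan eqxx big_seq big1 ?addr0//.
by move=> x; rewrite in_fsetD1 => /andP[/negbTE ->].
Qed.

Lemma plan_diagonal F w : (forall x, 0 <= w x) -> plan F w w (diagonal_plan w).
Proof.
move=> w0; split=> [x y|x xF|y yF]; first by rewrite /diagonal_plan; case: ifP.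
  exact: sum_diagonal_planl.
exact: sum_diagonal_planr.
Qed.

Lemma plan_cost_diagonal F w : plan_cost F (diagonal_plan w) = 0.
Proof.
rewrite /plan_cost big1// => x _; rewrite big1// => y _.
by rewrite /diagonal_plan; case: eqVneq => [->|_]; rewrite ?mdistxx ?mulr0 ?mul0r.
Qed.

Definition convex_weights (s : R) w v (x : X) : R := (1 - s) * w x + s * v x.

Lemma weights_convex F s w v : 0 <= s <= 1 -> weights F w -> weights F v ->
  weights F (convex_weights s w v).
Proof.
move=> /andP[s0 s1] [w0 wF w1] [v0 vF v1]; split=> [x|x xF|].
- by rewrite addr_ge0// mulr_ge0// subr_ge0.
- by rewrite /convex_weights wF// vF// !mulr0 addr0.
- by rewrite big_split/= -!mulr_sumr w1 v1; ring.
Qed.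

(** Mixing optimal plans gives a plan between the mixtures. *)
Lemma wdist_convex F s w v w' v' : 0 <= s <= 1 ->
  weights F w -> weights F v -> weights F w' -> weights F v' ->
  wdist (convex_weights s w v) (convex_weights s w' v') <=
  (1 - s) * wdist w w' + s * wdist v v'.
Proof.
move=> s01 Fw Fv Fw' Fv'; case/andP: (s01) => s0 s1.
have t0 : 0 <= 1 - s by rewrite subr_ge0.
apply/ler_addgt0Pl => e e0.
have [|g pg gc] := plan_exists Fw Fw' (c := wdist w w' + e); first by rewrite ltrDl.
have [|h ph hc] := plan_exists Fv Fv' (c := wdist v v' + e); first by rewrite ltrDl.
have := wdist_le_plan (weights_convex s01 Fw Fv) (weights_convex s01 Fw' Fv')
  (planD (planZ t0 pg) (planZ s0 ph)).
move/le_trans; apply; rewrite plan_costD !plan_costZ.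
have := ler_wpM2l t0 (ltW gc); have := ler_wpM2l s0 (ltW hc); lra.
Qed.

(** The mass common to both mixtures stays in place; only the difference of
the parameters has to be transported. *)
Lemma wdist_convex_param_le F s s' w v : 0 <= s <= s' -> s' <= 1 ->
  weights F w -> weights F v ->
  wdist (convex_weights s w v) (convex_weights s' w v) <= (s' - s) * wdist w v.
Proof.
move=> /andP[s0 ss'] s'1 Fw Fv; apply/ler_addgt0Pl => e e0.
have [|g pg gc] := plan_exists Fw Fv (c := wdist w v + e); first by rewrite ltrDl.
have d0 : 0 <= s' - s by rewrite subr_ge0.
have t0 : 0 <= 1 - s' by rewrite subr_ge0.
have s'0 : 0 <= s' by exact: le_trans ss'.
have s1 : s <= 1 by exact: le_trans ss' _.
have p : plan F (convex_weights s w v) (convex_weights s' w v)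
    (fun x y => (1 - s') * diagonal_plan w x y + s * diagonal_plan v x y
                + (s' - s) * g x y).
  have [w0 _ _] := Fw; have [v0 _ _] := Fv.
  have := planD (planD (planZ t0 (plan_diagonal F w0))
    (planZ s0 (plan_diagonal F v0))) (planZ d0 pg).
  by congr plan; apply/funext => x; rewrite /convex_weights; ring.
have Fs : weights F (convex_weights s w v).
  by apply: weights_convex => //; rewrite s0.
have Fs' : weights F (convex_weights s' w v).
  by apply: weights_convex => //; rewrite s'0.
have := wdist_le_plan Fs Fs' p.
rewrite !plan_costD !plan_costZ !plan_cost_diagonal !mulr0 !add0r.
move=> /le_trans; apply.
have := ler_wpM2l d0 (ltW gc); have : (s' - s) * e <= e; last by lra.
by rewrite ler_piMl ?(ltW e0)//; lra.
Qed.

Lemma wdist_sym F w v : weights F w -> weights F v -> wdist w v = wdist v w.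
Proof. by move=> Fw Fv; apply: wasserstein_sym; apply: weights_prob; eassumption. Qed.

Lemma wdist_convex_param F s s' w v : 0 <= s <= 1 -> 0 <= s' <= 1 ->
  weights F w -> weights F v ->
  wdist (convex_weights s w v) (convex_weights s' w v) <= `|s - s'| * wdist w v.
Proof.
move=> s01 s'01 Fw Fv; case/andP: (s01) (s'01) => s0 s1 /andP[s'0 s'1].
have [ss'|/ltW ss'] := leP s s'.
  rewrite distrC ger0_norm ?subr_ge0//.
  by apply: wdist_convex_param_le Fw Fv => //; rewrite s0.
rewrite ger0_norm ?subr_ge0//.
rewrite (wdist_sym (weights_convex s01 Fw Fv) (weights_convex s'01 Fw Fv)).
by apply: wdist_convex_param_le Fw Fv => //; rewrite s'0.
Qed.

(** Keeping the common mass in place, at most the sum of the coordinatewise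
differences is moved, over a distance at most [K]. *)
Lemma wdist_le_l1 F w v K : 0 <= K -> weights F w -> weights F v ->
  (forall x y, w x != 0 -> v y != 0 -> mdist x y <= K) ->
  wdist w v <= K * \sum_(x <- F) `|w x - v x|.
Proof.
move=> K0 Fw Fv dK; case: (Fw) (Fv) => w0 _ w1 [v0 _ _].
pose m x := Num.min (w x) (v x).
have m0 x : 0 <= m x by rewrite le_min w0 v0.
have [g0 gw gv] := plan_diagonal F m0.
have := wdist_partial_plan Fw Fv g0 _ _ dK.
rewrite plan_cost_diagonal add0r => /(_ _ _)/le_trans; apply.
- by move=> x xF; rewrite gw// ge_min lexx.
- by move=> x xF; rewrite gv// ge_min lexx orbT.
- rewrite ler_wpM2l// -w1 -sumrB big_seq [leRHS]big_seq.
  apply: ler_sum => x xF; rewrite gw// /m.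
  have [_|_] := leP (w x) (v x); first by rewrite subrr normr_ge0.
  exact: ler_norm.
Qed.

Definition lipschitz_bump (L : R) (phi : X -> R) : Prop :=
  (forall x, 0 <= phi x <= 1) /\
  forall x y, `|phi x - phi y| <= L * mdist x y.

Definition integral F w (phi : X -> R) : R := \sum_(x <- F) phi x * w x.

Definition restrict_weights F phi w (x : X) : R :=
  phi x * w x / integral F w phi.

Lemma weights_restrict F w phi : (forall x, 0 <= phi x) -> weights F w ->
  0 < integral F w phi -> weights F (restrict_weights F phi w).
Proof.
move=> p0 [w0 wF w1] m0; split=> [x|x xF|].
- by rewrite divr_ge0 ?mulr_ge0// ltW.
- by rewrite /restrict_weights wF// mulr0 mul0r.
- by rewrite -mulr_suml divff// gt_eqF.
Qed.

Lemma integral_lipschitz F w v phi L c : 0 <= L -> lipschitz_bump L phi ->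
  weights F w -> weights F v -> wdist w v < c ->
  `|integral F w phi - integral F v phi| <= L * c.
Proof.
move=> L0 [_ pL] Fw Fv /(plan_exists Fw Fv)[g [g0 gw gv] gc].
have -> : integral F w phi = \sum_(x <- F) \sum_(y <- F) phi x * g x y.
  rewrite /integral big_seq [RHS]big_seq; apply: eq_bigr => x xF.
  by rewrite -mulr_sumr gw.
have -> : integral F v phi = \sum_(x <- F) \sum_(y <- F) phi y * g x y.
  rewrite exchange_big/= /integral big_seq [RHS]big_seq; apply: eq_bigr => y yF.
  by rewrite -mulr_sumr gv.
rewrite -sumrB (le_trans (ler_norm_sum _ _ _))//.
apply: (le_trans _ (ler_wpM2l L0 (ltW gc))).
rewrite /plan_cost mulr_sumr; apply: ler_sum => x _.
rewrite -sumrB (le_trans (ler_norm_sum _ _ _))// mulr_sumr; apply: ler_sum => y _.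
rewrite -mulrBl normrM (ger0_norm (g0 _ _)) mulrCA mulrC.
by rewrite ler_wpM2l.
Qed.

(** The plan [min (phi x) (phi y) * g x y], divided by the larger of the two
integrals, is a partial plan between the restrictions; its defect is controlled
by the variation of [phi] along [g]. *)
Lemma wdist_restrict F w v phi L c K : 0 <= L -> 0 <= K -> lipschitz_bump L phi ->
  weights F w -> weights F v -> 0 < integral F w phi -> 0 < integral F v phi ->
  (forall x y, w x != 0 -> v y != 0 -> mdist x y <= K) ->
  wdist w v < c ->
  wdist (restrict_weights F phi w) (restrict_weights F phi v) <=
  (1 + K * (2 * L)) / integral F w phi * c.
Proof.
move=> L0 K0 pL Fw Fv mw0 mv0 dK Wc.
have mL := integral_lipschitz L0 pL Fw Fv Wc.
have [g [g0 gw gv] gc] := plan_exists Fw Fv Wc.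
have [p01 pL'] := pL.
have p0 x : 0 <= phi x by have /andP[] := p01 x.
have p1 x : phi x <= 1 by have /andP[] := p01 x.
set m := integral F w phi in mw0 mL *; set m' := integral F v phi in mv0 mL *.
pose M := Num.max m m'.
have mM : m <= M by rewrite le_max lexx.
have m'M : m' <= M by rewrite le_max lexx orbT.
have M0 : 0 < M by exact: lt_le_trans mM.
pose mu x y := Num.min (phi x) (phi y).
have mu0 x y : 0 <= mu x y by rewrite le_min !p0.
have mul x y : mu x y <= phi x by rewrite ge_min lexx.
have mur x y : mu x y <= phi y by rewrite ge_min lexx orbT.
pose h x y := mu x y * g x y / M.
have c0 : 0 <= c by apply: ltW; exact: le_lt_trans (wdist_ge0 Fw Fv) Wc.
have := wdist_partial_plan (g := h) (K := K) (weights_restrict p0 Fw mw0)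
  (weights_restrict p0 Fv mv0).
move=> /(_ _ _ _ _)/le_trans; apply.
- by move=> x y; rewrite divr_ge0 ?mulr_ge0// ltW.
- move=> x xF; rewrite -mulr_suml /restrict_weights -/m -gw// mulr_sumr.
  apply: ler_pM; first by rewrite sumr_ge0// => y _; rewrite mulr_ge0.
  + by rewrite invr_ge0 ltW.
  + by apply: ler_sum => y _; rewrite ler_wpM2r.
  + by rewrite lef_pV2.
- move=> y yF; rewrite -mulr_suml /restrict_weights -/m' -gv// mulr_sumr.
  apply: ler_pM; first by rewrite sumr_ge0// => x _; rewrite mulr_ge0.
  + by rewrite invr_ge0 ltW.
  + by apply: ler_sum => x _; rewrite ler_wpM2r.
  + by rewrite lef_pV2.
- move=> x y; rewrite /restrict_weights => wx vy; apply: dK.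
    by apply: contra wx => /eqP ->; rewrite mulr0 mul0r.
  by apply: contra vy => /eqP ->; rewrite mulr0 mul0r.
have -> : (1 + K * (2 * L)) / m * c = c / m + K * (2 * L * c / m) by ring.
apply: lerD.
  apply: (@le_trans _ _ (plan_cost F g / m)); last first.
    by rewrite ler_pM2r ?invr_gt0// ltW.
  rewrite /plan_cost mulr_suml; apply: ler_sum => x _.
  rewrite mulr_suml; apply: ler_sum => y _; rewrite /h mulrAC.
  apply: ler_pM; rewrite ?invr_ge0 ?lef_pV2 ?(ltW M0)//.
    by rewrite mulr_ge0 ?mdist_ge0// mulr_ge0.
  by rewrite ler_wpM2r ?mdist_ge0// ler_piMl// (le_trans (mul x y)).
rewrite ler_wpM2l//.
have hE : \sum_(x <- F) \sum_(y <- F) h x y =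
    (\sum_(x <- F) \sum_(y <- F) mu x y * g x y) / M.
  by rewrite mulr_suml; apply: eq_bigr => x _; rewrite mulr_suml.
have lb : m - L * c <= \sum_(x <- F) \sum_(y <- F) mu x y * g x y.
  rewrite lerBlDr.
  have -> : m = \sum_(x <- F) \sum_(y <- F) phi x * g x y.
    rewrite /m /integral big_seq [RHS]big_seq; apply: eq_bigr => x xF.
    by rewrite -mulr_sumr gw.
  apply: le_trans (lerD (lexx _) (ler_wpM2l L0 (ltW gc))).
  rewrite /plan_cost mulr_sumr -big_split/=; apply: ler_sum => x _.
  rewrite mulr_sumr -big_split/=; apply: ler_sum => y _.
  have : phi x - mu x y <= L * mdist x y.
    rewrite /mu; have [_|_] := leP (phi x) (phi y).
      by rewrite subrr mulr_ge0// mdist_ge0.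
    by rewrite (le_trans (ler_norm _)).
  by move/(ler_wpM2l (g0 x y)); lra.
have ub : M <= m + L * c.
  have := ler_norm (m' - m); rewrite distrC => /le_trans/(_ mL) ?.
  by rewrite /M ge_max lerDl mulr_ge0//= -lerBlDl.
have Lc0 : 0 <= L * c by rewrite mulr_ge0.
rewrite hE; set S := \sum_(x <- F) _ in lb *.
have -> : 1 - S / M = (M - S) / M by field; rewrite gt_eqF.
apply: (@le_trans _ _ (2 * L * c / M)).
  rewrite ler_pM2r ?invr_gt0//; lra.
by rewrite ler_wpM2l ?lef_pV2// -mulrA mulr_ge0.
Qed.

End Plans.

(** * The weak topology and tame maps *)

Section Thickening.
Context {R : realType} {X : metricType R} {U : set (set X)}.
Implicit Types (m n : thickening U) (w : X -> R) (F : {fset X}).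

Definition fsupp m : {fset X} := fset_set (supp (mass m)).

Lemma finite_supp m : finite_set (supp (mass m)).
Proof. by have [] := finsupp_massP (meas_prob m). Qed.

Lemma in_fsupp m x : (x \in fsupp m) = (mass m x != 0).
Proof.
rewrite in_fset_set; last exact: finite_supp.
by apply/idP/idP; rewrite inE.
Qed.

Lemma mass_weights F m : {subset fsupp m <= F} -> weights F (mass m).
Proof.
move=> sF; have [_ m0 m1] := finsupp_massP (meas_prob m); split=> //.
  by move=> x; apply: contraNeq => mx; apply: sF; rewrite in_fsupp.
rewrite -m1; apply/esym/fsum_fset.
  by move=> x mx; apply: sF; rewrite in_fsupp.
by move=> x _ /negP; rewrite negbK => /eqP.
Qed.

Lemma mdist_wdist m n : mdist m n = wdist (mass m) (mass n).
Proof.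
rewrite /mdist/= /thickening_dist /wdist.
have E (p : thickening U) : dirac_sum (mass p) = p :> (set X -> R).
  by have [w [_ _ _ pw]] := meas_prob p; rewrite pw mass_dirac_sum.
by rewrite !E.
Qed.

Definition admissible w : Prop :=
  (exists F, weights F w) /\ exists2 V, U V & supp w `<=` V.

Lemma thickening_of_weights w : admissible w ->
  exists m : thickening U, mass m = w.
Proof.
move=> [[F Fw] [V UV wV]].
have sw : exists2 V, U V & supp (mass (dirac_sum w)) `<=` V.
  by rewrite mass_dirac_sum; exists V.
by exists (Thickening (weights_prob Fw) sw); rewrite /= mass_dirac_sum.
Qed.

(** The default value makes this total, so that families of measures can be given by
formulas that define points of the thickening only near a given parameter. *)
Definition thicken (d : thickening U) w : thickening U :=
  if pselect (admissible w) is left aw then projT1 (cid (thickening_of_weights aw))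
  else d.

Lemma mass_thicken d w : admissible w -> mass (thicken d w) = w.
Proof. by rewrite /thicken; case: pselect => // aw _; case: cid. Qed.

Definition realize m : realization U := projT1 (cid
  (let: Bijective g _ gK := @natural_map_bij R X U in
   ex_intro (fun a => natural_map a = m) (g m) (gK m))).

Lemma realizeK : cancel realize (@natural_map R X U).
Proof. by move=> m; rewrite /realize; case: cid. Qed.

Lemma natural_mapK : cancel (@natural_map R X U) realize.
Proof.
have [g fK gK] := @natural_map_bij R X U.
by move=> a; apply: (can_inj fK); rewrite realizeK.
Qed.

Lemma mass_natural_map (a : realization U) : mass (natural_map a) = a.
Proof. exact: mass_dirac_sum. Qed.

Lemma coord_realize m : realize m = mass m :> (X -> R).
Proof. by rewrite -{2}(realizeK m) mass_natural_map. Qed.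

Lemma bounded_diameter : uniformly_bounded U ->
  exists2 D : R, 0 <= D & forall V x y, U V -> V x -> V y -> mdist x y <= D.
Proof.
move=> [D UD]; exists `|D| => // V x y UV Vx Vy.
apply: le_trans (ler_norm D); rewrite -lee_fin; apply: le_trans (UD _ UV).
by apply: ereal_sup_ubound; exists x => //; exists y.
Qed.

(** If all points of one support had distance at least 1 from all points of the
other, every plan would cost at least 1.  So some two points are closer, and the
bound on the diameters gives the rest. *)
Lemma supp_dist_le D m n x y :
  (forall V x y, U V -> V x -> V y -> mdist x y <= D) ->
  mdist m n < 1 -> mass m x != 0 -> mass n y != 0 -> mdist x y <= 2 * D + 1.
Proof.
move=> UD mn1 mx ny; pose F := (fsupp m `|` fsupp n)%fset.
have Fm : weights F (mass m).
  by apply: mass_weights => z zm; rewrite in_fsetU zm.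
have Fn : weights F (mass n).
  by apply: mass_weights => z zm; rewrite in_fsetU zm orbT.
have [|g [g0 gm gn] g1] := plan_exists Fm Fn (c := 1); first by rewrite -mdist_wdist.
have [x' [y' [mx' ny' xy']]] : exists x' y',
    [/\ mass m x' != 0, mass n y' != 0 & mdist x' y' < 1].
  apply: contrapT => far; move: g1; apply/negP; rewrite -leNgt.
  have [_ _ <-] := Fm; rewrite /plan_cost big_seq [leRHS]big_seq.
  apply: ler_sum => x' x'F; rewrite -gm// big_seq [leRHS]big_seq.
  apply: ler_sum => y' y'F.
  have [mx'|mx'] := eqVneq (mass m x') 0.
    have /eqP := gm _ x'F; rewrite mx' psumr_eq0//.
    by move=> /allP/(_ _ y'F)/= /eqP ->; rewrite mul0r.
  have [ny'|ny'] := eqVneq (mass n y') 0.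
    have /eqP := gn _ y'F; rewrite ny' psumr_eq0//.
    by move=> /allP/(_ _ x'F)/= /eqP ->; rewrite mul0r.
  rewrite ler_peMr// leNgt; apply/negP => xy'.
  by apply: far; exists x', y'.
have [V UV mV] := meas_supp m; have [V' UV' nV'] := meas_supp n.
have := UD _ x x' UV (mV _ mx) (mV _ mx').
have := UD _ y' y UV' (nV' _ ny') (nV' _ ny).
have := metric_triangle x x' y; have := metric_triangle x' y' y; lra.
Qed.

End Thickening.

Section Tame.
Context {R : realType} {X : metricType R} {U : set (set X)}.
Implicit Types (m n : thickening U) (F : {fset X}).

(** This expresses continuity for the weak topology by finitely many coordinates at
a time, so that it can be checked on maps given by formulas. *)
Definition tame {Y : topologicalType} (u : Y -> thickening U) (t : Y) : Prop :=
  (exists F, \forall t' \near t, {subset fsupp (u t') <= F}) /\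
  forall x, {for t, continuous (fun t' => mass (u t') x)}.

Lemma tame_near_eq {Y : topologicalType} (u v : Y -> thickening U) t :
  (\forall t' \near t, v t' = u t') -> tame u t -> tame v t.
Proof.
move=> uv [[F uF] cu]; split.
  by exists F; near=> t'; rewrite (near uv t')//; exact: (near uF t').
move=> x; rewrite /prop_for /continuous_at (nbhs_singleton uv).
apply: cvg_trans (cu x); apply: near_eq_cvg.
by near=> t'; rewrite (near uv t').
Unshelve. all: by end_near. Qed.

Lemma tame_cst {Y : topologicalType} m (t : Y) : tame (cst m) t.
Proof.
split; first by exists (fsupp m); near=> t'.
by move=> x; exact: cvg_cst.
Unshelve. all: by end_near. Qed.

(** Near [t], the support of [u t'] is one of the finitely many simplices with
vertices in [F] that contain the support of [u t]; each of them requires the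
coordinates to be close up to some positive bound. *)
Lemma tame_continuous {Y : topologicalType} (u : Y -> thickening U) t :
  tame u t -> {for t, continuous (realize \o u)}.
Proof.
move=> [[F uF] cu] W; rewrite nbhsE => -[W' [oW' W't] W'W].
suff : \forall t' \near t, W' (realize (u t')) by apply: filterS => t' /W'W.
have posF : \forall t' \near t, forall x, x \in fsupp (u t) -> mass (u t') x != 0.
  apply: near_fset => x; rewrite in_fsupp => ux.
  by apply: cvgr_neq0 ux; exact: cu.
have near_simplex : \forall t' \near t, forall s, s \in fpowerset F ->
    vietoris U [set` s] -> {subset fsupp (u t) <= s} ->
    {subset fsupp (u t') <= s} -> W' (realize (u t')).
  apply: near_fset => s _.
  have [[Us us]|nUs] := pselect (vietoris U [set` s] /\ {subset fsupp (u t) <= s});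
    last by near=> t' => Us us; case: nUs.
  have [|e e0 eW] := oW' _ Us (realize (u t)) _ W't.
    by move=> x; rewrite /supp/= coord_realize => ux; apply: us; rewrite in_fsupp.
  have : \forall t' \near t, forall x, x \in s ->
      `|mass (u t) x - mass (u t') x| < e.
    by apply: near_fset => x _; apply: cvgr_dist_lt e0; exact: cu.
  apply: filterS => t' ut' _ _ us'; apply: eW => [x|x xs].
    by rewrite /supp/= coord_realize => ux; apply: us'; rewrite in_fsupp.
  by rewrite !coord_realize; exact: ut'.
near=> t'.
have t'F : {subset fsupp (u t') <= F} by exact: (near uF t').
have tt' : forall x, x \in fsupp (u t) -> mass (u t') x != 0.
  exact: (near posF t').
apply: (near near_simplex t' _ (fsupp (u t'))) => // [||x xt].
- by rewrite fpowersetE; apply/fsubsetP.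
- have [V UV uV] := meas_supp (u t'); split; first exact: finite_fset.
  by exists V => // x /=; rewrite in_fsupp => /uV.
- by rewrite in_fsupp tt'.
Unshelve. all: by end_near. Qed.

(** On a simplex the Wasserstein distance is at most the bound on the diameters
times the l1 distance of the coordinates. *)
Lemma natural_map_continuous : uniformly_bounded U ->
  continuous (@natural_map R X U).
Proof.
move=> /bounded_diameter[D D0 UD]; apply/continuousP => A oA.
suff : weak_open (natural_map (U := U) @^-1` A) by [].
move=> s Us a sa Aa.
have [e e0 eA] : exists2 e : R, 0 < e & forall m, mdist (natural_map a) m < e -> A m.
  have /nbhs_ballP[e e0 eA] : nbhs (natural_map a) A by exact: open_nbhs_nbhs.
  by exists e => // m am; apply: eA; rewrite ballEmdist.
have [fs [V UV sV]] := Us.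
have [F sF] : exists F : {fset X}, s = [set` F].
  by exists (fset_set s); rewrite fset_setK.
pose n := (#|` F|)%:R : R.
have n0 : 0 <= n by exact: ler0n.
have p0 : 0 < D * n + 1 by rewrite ltr_wpDl// mulr_ge0.
exists (e / (D * n + 1)) => [|b sb ab]; first by rewrite divr_gt0.
apply: eA; rewrite mdist_wdist !mass_natural_map.
have Fw (c : realization U) : closed_simplex s c -> weights F c.
  move=> sc; rewrite -mass_natural_map; apply: mass_weights => x.
  by rewrite in_fsupp mass_natural_map => /sc; rewrite sF.
apply: (@le_lt_trans _ _ (D * \sum_(x <- F) `|a x - b x|)).
  apply: wdist_le_l1 => //; [exact: Fw|exact: Fw|move=> x y ax bY].
  by apply: UD UV _ _; apply: sV; [exact: sa|exact: sb].
apply: (@le_lt_trans _ _ (D * (n * (e / (D * n + 1))))).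
  rewrite ler_wpM2l// (_ : n * _ = \sum_(x <- F) (e / (D * n + 1))).
    by rewrite big_seq [leRHS]big_seq; apply: ler_sum => x xF; apply/ltW/ab; rewrite sF.
  by rewrite big_const_seq count_predT iter_addr addr0 mulr_natl.
rewrite mulrA mulrCA gtr_pMr// ltr_pdivrMr// mul1r; lra.
Qed.

(** If the supports of [r] near [t] do not stay in a finite set, then there are [t_k]
tending to [t] and distinct vertices [x_k] outside the support of [r t] with
[x_k] in the support of [r t_k].  A simplex contains finitely many of the
[x_k], so the points whose [x_k]-th coordinate is smaller than that of [r t_k],
for all [k], form an open neighbourhood of [r t], which avoids every [r t_k]. *)
Lemma continuous_locally_finite {Y : pseudoMetricType R}
    (r : Y -> realization U) t : {for t, continuous r} ->
  exists F : {fset X}, \forall t' \near t, supp (r t') `<=` [set` F].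
Proof.
move=> cr; apply: contrapT => /forallNP nF.
have pickP (Fk : {fset X} * nat) : exists tx : Y * X,
    [/\ ball t Fk.2.+1%:R^-1 tx.1, tx.2 \notin Fk.1 & r tx.1 tx.2 != 0].
  apply: contrapT => none; apply: (nF Fk.1).
  have k0 : 0 < Fk.2.+1%:R^-1 :> R by rewrite invr_gt0.
  apply/nbhs_ballP; exists (Fk.2.+1%:R^-1) => // t' tt' x rx.
  apply: contrapT => /negP xF; apply: none.
  by exists (t', x).
have {pickP}[p pP] := choice pickP.
pose F0 := fsupp (natural_map (r t)).
pose step (Fk : {fset X} * nat) := ((p Fk).2 |` Fk.1, Fk.2.+1)%fset.
pose Fk k := iter k step (F0, 0%N).
have Fk2 k : (Fk k).2 = k by elim: k => //= k ->.
pose x k := (p (Fk k)).2; pose v k := (p (Fk k)).1.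
have FS k : (Fk k.+1).1 = (x k |` (Fk k).1)%fset by [].
have Fle j k : (j <= k)%N -> {subset (Fk j).1 <= (Fk k).1}.
  move=> /subnK <-; elim: (k - j)%N => // i IH z /IH zF.
  by rewrite addSn FS in_fsetU zF orbT.
have xF j k : (j < k)%N -> x j \in (Fk k).1.
  by move=> /Fle; apply; rewrite FS in_fsetU in_fset1 eqxx.
have vP k : [/\ ball t k.+1%:R^-1 (v k), x k \notin (Fk k).1 & r (v k) (x k) != 0].
  by have := pP (Fk k); rewrite Fk2.
have F00 : (Fk 0%N).1 = F0 by [].
clearbody x v Fk; have xN k : x k \notin (Fk k).1 by have [] := vP k.
have xI j k : x j = x k -> j = k.
  move=> jk; case: (ltngtP j k) => // /xF.
    by rewrite jk (negbTE (xN k)).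
  by rewrite -jk (negbTE (xN j)).
pose W := [set b : realization U | forall k, b (x k) < r (v k) (x k)].
have rv0 k : 0 < r (v k) (x k).
  have [_ _ rx] := vP k; rewrite lt_neqAle eq_sym rx.
  by have /andP[] := coord_itv (r (v k)) (x k).
have oW : open W.
  suff : weak_open W by [].
  move=> s [fs _] a sa aW.
  have [||e e0 He] := @fset_uniform_pos R X (fset_set s)
    (fun y e => forall k, x k = y -> a y + e <= r (v k) y).
  - move=> y _; have [[k xk]|nk] := pselect (exists k, x k = y); last first.
      by exists 1 => // k xk; case: nk; exists k.
    exists (r (v k) y - a y) => [|j]; first by rewrite subr_gt0 -xk.
    by rewrite -xk => /xI ->; rewrite addrC subrK.
  - move=> y e e' /andP[e'0 e'e] H k /H; apply: le_trans.
    by rewrite lerD2l.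
  exists e => // b sb ab k.
  have [xs|xs] := pselect (s (x k)); last first.
    by rewrite (_ : b _ = 0)//; apply/eqP; apply: contra_notT xs => /sb.
  have /He/(_ k erefl) : x k \in fset_set s by rewrite in_fset_set// mem_set.
  apply: lt_le_trans; rewrite -ltrBlDl.
  by apply: le_lt_trans (ab _ xs); rewrite distrC ler_norm.
have Wt : W (r t).
  move=> k; rewrite (_ : r t (x k) = 0)//; apply/eqP; apply: contraNT (xN k) => rt.
  by apply: (Fle 0%N) => //; rewrite F00 in_fsupp mass_natural_map.
have /nbhs_ballP[e /= e0 eW] : nbhs t (r @^-1` W).
  by apply: cr; exact: open_nbhs_nbhs.
have [k ke] : exists k, k.+1%:R^-1 < e.
  exists (Num.trunc e^-1); rewrite invf_plt ?posrE//.
  exact: truncnS_gt.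
have /eW/(_ k) : ball t e (v k); last by rewrite /= ltxx.
have [+ _ _] := vP k; apply: le_ball; exact: ltW.
Qed.

Lemma coord_continuous_realization x :
  continuous (fun a : realization U => a x : R).
Proof.
move=> a A /nbhs_ballP[e /= e0 eA]; rewrite /= nbhsE.
exists [set b : realization U | `|a x - b x| < e]; last by move=> b; exact: eA.
split; last by rewrite /= subrr normr0.
suff : weak_open [set b : realization U | `|a x - b x| < e] by [].
move=> s Us b sb /= abx.
have [xs|xs] := pselect (s x); last first.
  have c0 (c : realization U) : closed_simplex s c -> c x = 0.
    by move=> sc; apply/eqP; apply: contra_notT xs => /sc.
  by exists 1 => // c sc _; rewrite (c0 c sc) -(c0 b sb).
exists (e - `|a x - b x|) => [|c sc bc]; first by rewrite subr_gt0.
have := bc _ xs; have := ler_distD (b x) (a x) (c x); lra.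
Qed.

Lemma continuous_tame {Y : pseudoMetricType R} (r : Y -> realization U) t :
  {for t, continuous r} -> tame (@natural_map R X U \o r) t.
Proof.
move=> cr; split=> [|x].
  have [F rF] := continuous_locally_finite cr; exists F.
  apply: filterS rF => t' rF x; rewrite in_fsupp mass_natural_map; exact: rF.
apply: (@cvg_trans _ ((fun a : realization U => a x) \o r @ t)).
  by apply: near_eq_cvg; near=> t'; rewrite /= mass_natural_map.
rewrite /= mass_natural_map.
exact: (cvg_comp r (fun a : realization U => a x : R) cr (coord_continuous_realization (x0 := r t))).
Unshelve. all: by end_near. Qed.

End Tame.

(** * Contracting small balls of the thickening *)

Section Bump.
Context {R : realType} {X : metricType R}.

Lemma max_lipschitz (a b c d e : R) : `|a - c| <= e -> `|b - d| <= e ->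
  `|Num.max a b - Num.max c d| <= e.
Proof.
rewrite !ler_norml => /andP[? ?] /andP[? ?].
by case: (leP a b); case: (leP c d); lra.
Qed.

(** The function is the maximum of cones with small support around the points of
[s]. *)
Lemma exists_bump (V : set X) (s : seq X) : open V -> {in s, forall z, V z} ->
  exists L phi, [/\ 0 <= L, lipschitz_bump L phi, {in s, forall z, phi z = 1} &
    forall x, phi x != 0 -> V x].
Proof.
move=> oV; elim: s => [_|z s IH sV].
  exists 0, (fun=> 0); split => //; last by move=> x; rewrite eqxx.
  split=> [x|x y]; first by rewrite lexx ler01.
  by rewrite subrr normr0 mul0r.
have [|L [phi [L0 [p01 pL] p1 pV]]] := IH.
  by move=> y ys; apply: sV; rewrite inE ys orbT.
have Vz : V z by apply: sV; exact: mem_head.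
have [r r0 rV] : exists2 r : R, 0 < r & forall x, mdist z x < r -> V x.
  have /nbhs_ballP[r r0 rV] : nbhs z V by exact: open_nbhs_nbhs.
  by exists r => // x zx; apply: rV; rewrite ballEmdist.
pose psi x := Num.max 0 (1 - mdist z x / r).
have rI0 : 0 < r^-1 by rewrite invr_gt0.
have psi0 x : 0 <= psi x by rewrite le_max lexx.
have psi1 x : psi x <= 1.
  by rewrite ge_max ler01 gerBl divr_ge0 ?mdist_ge0// ltW.
have d0 x y : 0 <= mdist x y by exact: mdist_ge0.
exists (Num.max L r^-1), (fun x => Num.max (phi x) (psi x)); split.
- by rewrite le_max L0.
- split=> [x|x y].
    have /andP[p0 p1'] := p01 x.
    by rewrite le_max p0/= ge_max p1' psi1.
  apply: max_lipschitz.
    by rewrite (le_trans (pL x y))// ler_wpM2r// le_max lexx.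
  apply: (@le_trans _ _ (r^-1 * mdist x y)); last first.
    by rewrite ler_wpM2r// le_max lexx orbT.
  apply: max_lipschitz; first by rewrite subrr normr0 mulr_ge0// ltW.
  rewrite opprB addrC addrA subrK -mulrBl normrM mulrC.
  rewrite (gtr0_norm rI0) ler_pM2l// ler_norml.
  have := metric_triangle z x y; have := metric_triangle z y x.
  by rewrite (metric_sym y x); lra.
- move=> x; rewrite inE => /orP[/eqP ->|xs].
    rewrite /psi mdistxx mul0r subr0 (max_idPr ler01).
    by apply/max_idPr; have /andP[] := p01 z.
  by rewrite p1//; apply/max_idPl.
- move=> x; have [/pV//|] := boolP (phi x != 0).
  rewrite negbK => /eqP ->; rewrite (max_idPr (psi0 x)) => psix.
  apply: rV; rewrite ltNge; apply: contra psix => rx.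
  by apply/eqP/max_idPl; rewrite subr_le0 ler_pdivlMr// mul1r.
Qed.

End Bump.

Section Operations.
Context {R : realType} {X : metricType R} {U : set (set X)}.
Implicit Types (m n : thickening U) (phi : X -> R) (F : {fset X}).

Lemma thickening_cvgP {T : Type} {F : set_system T} {FF : Filter F}
    (u : T -> thickening U) m :
  u @ F --> m <-> forall e, 0 < e -> \forall t \near F, mdist m (u t) < e.
Proof. exact: metricType_numDomainType.cvgrPdist_lt. Qed.

Definition measure_integral phi m : R := integral (fsupp m) (mass m) phi.

Lemma integral_fsupp F phi m : {subset fsupp m <= F} ->
  integral F (mass m) phi = measure_integral phi m.
Proof.
move=> mF; apply/esym/big_fset_incl; first exact/fsubsetP.
by move=> x _; rewrite in_fsupp negbK => /eqP ->; rewrite mulr0.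
Qed.

Definition restriction phi m : thickening U :=
  thicken m (restrict_weights (fsupp m) phi (mass m)).

Lemma mass_restriction phi m x : (forall x, 0 <= phi x) ->
  0 < measure_integral phi m ->
  mass (restriction phi m) x = phi x * mass m x / measure_integral phi m.
Proof.
move=> p0 m0; rewrite mass_thicken//; split.
  by exists (fsupp m); apply: weights_restrict => //; exact: mass_weights.
have [V UV mV] := meas_supp m; exists V => // y; rewrite /supp/= => my.
apply: mV; apply: contra my => /eqP my.
by rewrite /restrict_weights my mulr0 mul0r.
Qed.

Lemma restriction_id phi m : (forall x, 0 <= phi x) ->
  (forall x, mass m x != 0 -> phi x = 1) ->
  measure_integral phi m = 1 /\ restriction phi m = m.
Proof.
move=> p0 p1.
have pm x : phi x * mass m x = mass m x.
  have [->|/p1 ->] := eqVneq (mass m x) 0; first by rewrite mulr0.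
  by rewrite mul1r.
have m1 : measure_integral phi m = 1.
  have [_ _ <-] := mass_weights (F := fsupp m) (m := m) (fun _ => id).
  by apply: eq_bigr => x _; exact: pm.
split=> //; apply: thickening_ext => x.
by rewrite mass_restriction ?m1// divr1 pm.
Qed.

Lemma common_weights m n : exists F,
  [/\ weights F (mass m), weights F (mass n), {subset fsupp m <= F} &
      {subset fsupp n <= F}].
Proof.
exists (fsupp m `|` fsupp n)%fset.
have mF : {subset fsupp m <= (fsupp m `|` fsupp n)%fset}.
  by move=> x xm; rewrite in_fsetU xm.
have nF : {subset fsupp n <= (fsupp m `|` fsupp n)%fset}.
  by move=> x xm; rewrite in_fsetU xm orbT.
by split=> //; exact: mass_weights.
Qed.

Definition mix (s : R) m n : thickening U :=
  thicken m (convex_weights s (mass m) (mass n)).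

(** The condition bears on the support of the mixture, which can be smaller than the
union of the two supports if [s] is 0 or 1; see the first half of [deform]. *)
Definition mixable (s : R) m n : Prop := 0 <= s <= 1 /\
  exists2 V, U V & supp (convex_weights s (mass m) (mass n)) `<=` V.

Lemma mass_mix s m n : mixable s m n ->
  mass (mix s m n) = convex_weights s (mass m) (mass n).
Proof.
move=> [s01 sV]; rewrite mass_thicken//; split => //.
have [F [Fm Fn _ _]] := common_weights m n.
by exists F; exact: weights_convex.
Qed.

Lemma mixable0 m n : mixable 0 m n.
Proof.
split; first by rewrite lexx ler01.
have [V UV mV] := meas_supp m; exists V => // x; rewrite /supp/= /convex_weights.
by rewrite subr0 mul1r mul0r addr0 => /mV.
Qed.

Lemma mix0 m n : mix 0 m n = m.
Proof.
apply: thickening_ext => x; rewrite (mass_mix (mixable0 m n)) /convex_weights.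
by rewrite subr0 mul1r mul0r addr0.
Qed.

Lemma mixable1 m n : mixable 1 m n.
Proof.
split; first by rewrite lexx ler01.
have [V UV mV] := meas_supp n; exists V => // x; rewrite /supp/= /convex_weights.
by rewrite subrr mul1r mul0r add0r => /mV.
Qed.

Lemma mix1 m n : mix 1 m n = n.
Proof.
apply: thickening_ext => x; rewrite (mass_mix (mixable1 m n)) /convex_weights.
by rewrite subrr mul1r mul0r add0r.
Qed.

Lemma mixable_common s m n V : 0 <= s <= 1 -> U V ->
  supp (mass m) `<=` V -> supp (mass n) `<=` V -> mixable s m n.
Proof.
move=> s01 UV mV nV; split => //; exists V => // x; rewrite /supp/= => snz.
have [mx|] := eqVneq (mass m x) 0; last exact: mV.
have [nx|] := eqVneq (mass n x) 0; last exact: nV.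
by move: snz; rewrite /convex_weights mx nx !mulr0 addr0 eqxx.
Qed.

Lemma weights_union (F G : {fset X}) w v : weights F w -> weights G v ->
  weights (F `|` G)%fset w /\ weights (F `|` G)%fset v.
Proof.
move=> Fw Gv; split; [apply: weightsW Fw|apply: weightsW Gv] => x xF;
  by rewrite in_fsetU xF ?orbT.
Qed.

Lemma mix_dist_le s s' m n m' n' : mixable s m n -> mixable s' m' n' ->
  mdist (mix s m n) (mix s' m' n') <=
  `|s - s'| * mdist m n + mdist m m' + mdist n n'.
Proof.
move=> smn smn'; rewrite !mdist_wdist !mass_mix//.
have [s01 _] := smn; have [s'01 _] := smn'.
have [F [Fm Fn _ _]] := common_weights m n.
have [G [Gm Gn _ _]] := common_weights m' n'.
have [Hm Hm'] := weights_union Fm Gm; have [Hn Hn'] := weights_union Fn Gn.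
set H := (F `|` G)%fset in Hm Hm' Hn Hn'.
have := wasserstein_triangle (weights_prob (weights_convex s01 Hm Hn))
  (weights_prob (weights_convex s'01 Hm Hn))
  (weights_prob (weights_convex s'01 Hm' Hn')).
move/le_trans; apply; rewrite -addrA; apply: lerD.
  exact: wdist_convex_param Hm Hn.
apply: le_trans (wdist_convex s'01 Hm Hn Hm' Hn') _.
case/andP: s'01 => s'0 s'1.
by apply: lerD; rewrite ler_piMl ?(wdist_ge0 (F := H))// gerBl.
Qed.

Lemma mix_ball_center s c m n e : mixable s m n -> mdist c m < e ->
  mdist c n < e -> mdist c (mix s m n) < e.
Proof.
move=> smn cm cn; rewrite mdist_wdist mass_mix//.
have [s01 _] := smn; case/andP: (s01) => s0 s1.
have [F [Fm Fn _ _]] := common_weights m n.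
have Gc := mass_weights (F := fsupp c) (m := c) (fun _ => id).
have [Hm Hc] := weights_union Fm Gc; have [Hn _] := weights_union Fn Gc.
have := wdist_convex s01 Hc Hc Hm Hn.
have -> : convex_weights s (mass c) (mass c) = mass c.
  by apply/funext => x; rewrite /convex_weights; ring.
move/le_lt_trans; apply; rewrite -!mdist_wdist.
have t0 : 0 <= 1 - s by rewrite subr_ge0.
have [->|s_neq0] := eqVneq s 0; first by rewrite subr0 mul1r mul0r addr0.
have s_gt0 : 0 < s by rewrite lt_neqAle eq_sym s_neq0.
rewrite -(ltr_pM2l s_gt0) in cn.
have := ler_wpM2l t0 (ltW cm); lra.
Qed.

Section Families.
Context {Y : topologicalType}.
Implicit Types (u v : Y -> thickening U) (s : Y -> R) (t : Y).

Lemma near_mdist u t e : {for t, continuous u} -> 0 < e ->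
  \forall t' \near t, mdist (u t) (u t') < e.
Proof. by move=> /thickening_cvgP; exact. Qed.

Lemma continuous_measure_integral L phi u t : 0 <= L -> lipschitz_bump L phi ->
  {for t, continuous u} -> {for t, continuous (measure_integral phi \o u)}.
Proof.
move=> L0 pL cu; apply/real_continuousP => e e0.
have d0 : 0 < e / (L + 1) by rewrite divr_gt0// ltr_wpDl.
apply: filterS (near_mdist cu d0) => t' mn.
have [F [Fm Fn mF nF]] := common_weights (u t) (u t').
rewrite /= -(integral_fsupp _ mF) -(integral_fsupp _ nF).
rewrite mdist_wdist in mn.
apply: le_lt_trans (integral_lipschitz L0 pL Fm Fn mn) _.
by rewrite mulrCA gtr_pMr// ltr_pdivrMr ?mul1r ?ltrDl// ltr_wpDl.
Qed.

(** A small displacement of the measure changes its restriction little, because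
only little mass has to be moved in addition, over a bounded distance; this is
where the diameters of the cover have to be bounded. *)
Lemma continuous_restriction L phi u t : uniformly_bounded U ->
  0 <= L -> lipschitz_bump L phi -> 0 < measure_integral phi (u t) ->
  {for t, continuous u} -> {for t, continuous (restriction phi \o u)}.
Proof.
move=> /bounded_diameter[D D0 UD] L0 pL m0 cu; apply/thickening_cvgP => e e0.
have p0 x : 0 <= phi x by have [/(_ x)/andP[]] := pL.
(* By [supp_dist_le], this bounds the distances between the supports. *)
pose K := 2 * D + 1; have K0 : 0 <= K by rewrite addr_ge0// mulr_ge0.
pose C := (1 + K * (2 * L)) / measure_integral phi (u t).
have C0 : 0 < C by rewrite divr_gt0// ltr_pwDl// mulr_ge0// mulr_ge0.
have d0 : 0 < Num.min 1 (e / C / 2) by rewrite lt_min ltr01/= divr_gt0// divr_gt0.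
have n0 := near_gt0 (continuous_measure_integral L0 pL cu) m0.
apply: filterS2 (near_mdist cu d0) n0 => t'; rewrite lt_min => /andP[mn1 mn] n0.
have [F [Fm Fn mF nF]] := common_weights (u t) (u t').
have E p : {subset fsupp p <= F} -> 0 < measure_integral phi p ->
    mass (restriction phi p) = restrict_weights F phi (mass p).
  move=> pF p0'; apply/funext => x; rewrite mass_restriction//.
  by rewrite /restrict_weights integral_fsupp.
rewrite mdist_wdist /= E// E//.
have Wd : forall x y, mass (u t) x != 0 -> mass (u t') y != 0 -> mdist x y <= K.
  by move=> x y; exact: supp_dist_le UD mn1.
rewrite mdist_wdist in mn.
have := wdist_restrict L0 K0 pL Fm Fn _ _ Wd mn.
rewrite !integral_fsupp// => /(_ m0 n0)/le_lt_trans; apply.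
have -> : C * (e / C / 2) = e / 2 by field; rewrite gt_eqF.
lra.
Qed.

Lemma continuous_mix s u v t : {for t, continuous s} ->
  {for t, continuous u} -> {for t, continuous v} ->
  (\forall t' \near t, mixable (s t') (u t') (v t')) ->
  {for t, continuous (fun t' => mix (s t') (u t') (v t'))}.
Proof.
move=> cs cu cv suv; apply/thickening_cvgP => e e0.
have d0 : 0 <= mdist (u t) (v t) by exact: mdist_ge0.
have D0 : 0 < mdist (u t) (v t) + 1 by rewrite ltr_wpDl.
have e3 : 0 < e / 3 by rewrite divr_gt0.
have e4 : 0 < e / 3 / (mdist (u t) (v t) + 1) by rewrite divr_gt0.
near=> t'.
apply: le_lt_trans (mix_dist_le (nbhs_singleton suv) _) _.
  exact: (near suv t').
have s1 : `|s t - s t'| < e / 3 / (mdist (u t) (v t) + 1).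
  by near: t'; exact: cvgr_dist_lt.
have u1 : mdist (u t) (u t') < e / 3.
  by near: t'; exact: (thickening_cvgP _ _).1.
have v1 : mdist (v t) (v t') < e / 3.
  by near: t'; exact: (thickening_cvgP _ _).1.
have : `|s t - s t'| * mdist (u t) (v t) <= e / 3; last by lra.
rewrite ltr_pdivlMr// in s1; apply: le_trans (ltW s1).
by rewrite ler_wpM2l// lerDl.
Unshelve. all: by end_near. Qed.

Lemma tame_mix s u v t : {for t, continuous s} -> tame u t -> tame v t ->
  (\forall t' \near t, mixable (s t') (u t') (v t')) ->
  tame (fun t' => mix (s t') (u t') (v t')) t.
Proof.
move=> cs [[F uF] cu] [[G vG] cv] suv; split.
  exists (F `|` G)%fset; near=> t'; move=> x.
  rewrite in_fsupp mass_mix; last exact: (near suv t').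
  rewrite in_fsetU /convex_weights; apply: contraR; rewrite negb_or.
  move=> /andP[xF xG].
  have -> : mass (u t') x = 0.
    by apply/eqP; apply: contraNT xF; rewrite -in_fsupp; exact: (near uF t').
  have -> : mass (v t') x = 0.
    by apply/eqP; apply: contraNT xG; rewrite -in_fsupp; exact: (near vG t').
  by rewrite !mulr0 addr0.
move=> x; rewrite /prop_for /continuous_at mass_mix; last exact: nbhs_singleton suv.
apply: (@cvg_trans _
    ((fun t' => convex_weights (s t') (mass (u t')) (mass (v t')) x) @ t)).
  by apply: near_eq_cvg; near=> t'; rewrite mass_mix//; exact: (near suv t').
apply: cvgD; apply: cvgM; [|exact: cu|exact: cs|exact: cv].
by apply: cvgB; [exact: cvg_cst|exact: cs].
Unshelve. all: by end_near. Qed.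

Lemma tame_restriction phi u t : (forall x, 0 <= phi x) ->
  0 < measure_integral phi (u t) -> tame u t ->
  tame (fun t' => restriction phi (u t')) t.
Proof.
move=> p0 m0 [[F uF] cu].
pose I t' := \sum_(x <- F) phi x * mass (u t') x.
have IE t' : {subset fsupp (u t') <= F} -> I t' = measure_integral phi (u t').
  exact: integral_fsupp.
have cI : {for t, continuous I}.
  rewrite /prop_for /continuous_at /I; apply: cvg_big => [|x _]; first exact: add_continuous.
  by apply: cvgM; [exact: cvg_cst|exact: cu].
have posI : \forall t' \near t, 0 < I t'.
  by apply: (near_gt0 cI); rewrite IE//; exact: nbhs_singleton uF.
have posm : \forall t' \near t, 0 < measure_integral phi (u t').
  near=> t'; rewrite -IE; last exact: (near uF t').
  exact: (near posI t').
split.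
  exists F; near=> t' => x; rewrite in_fsupp mass_restriction//; last first.
    exact: (near posm t').
  move=> nz; apply: (near uF t') => //; rewrite in_fsupp.
  by apply: contra nz => /eqP ->; rewrite mulr0 mul0r.
move=> x; rewrite /prop_for /continuous_at mass_restriction//.
rewrite -IE; last exact: nbhs_singleton uF.
apply: (@cvg_trans _ ((fun t' => phi x * mass (u t') x / I t') @ t)).
  apply: near_eq_cvg; near=> t'; rewrite mass_restriction//; last first.
    exact: (near posm t').
  by rewrite IE//; exact: (near uF t').
apply: cvgM; first by apply: cvgM; [exact: cvg_cst|exact: cu].
by apply: cvgV; [rewrite gt_eqF//; exact: nbhs_singleton posI|exact: cI].
Unshelve. all: by end_near. Qed.

End Families.

(** The first half moves [m] to its restriction, without adding points to the
support, and the second half moves the restriction to [c]. *)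
Definition deform phi c (s : R) m : thickening U :=
  mix (clamp (2 * s - 1)) (mix (clamp (2 * s)) m (restriction phi m)) c.

(** [contracts c d e h] is the property of [h] that the construction of tame
approximations uses.  Continuity and tameness are required of the composites of
[h] with arbitrary families, so that no topology on the parameter space of [h]
enters. *)
Definition contracts c (d e : R) (h : R -> thickening U -> thickening U) : Prop :=
  [/\ forall m, mdist c m < d -> h 0 m = m,
      exists c', forall m, mdist c m < d -> h 1 m = c',
      forall s m, 0 <= s <= 1 -> mdist c m < d -> mdist c (h s m) < e &
      forall (Y : topologicalType) (b : Y -> R) (u : Y -> thickening U) t,
        {for t, continuous b} -> {for t, continuous u} -> mdist c (u t) < d ->
        {for t, continuous (fun t' => h (b t') (u t'))} /\
        (tame u t -> tame (fun t' => h (b t') (u t')) t)].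

(** The radius is such that the restriction exists and is close to [c].  During the
first half no mixing with [c] takes place, and in the second half only the
restriction, with support in [V], is mixed with [c]. *)
Lemma exists_contraction c e : open_cover U -> uniformly_bounded U -> 0 < e ->
  exists2 d, 0 < d & exists h, contracts c d e h.
Proof.
move=> [oU _] bU e0.
have [V UV cV] := meas_supp c.
have [||L [phi [L0 pL p1 pV]]] := @exists_bump R X V (fsupp c).
- exact: oU.
- by move=> x; rewrite in_fsupp => /cV.
have p0 x : 0 <= phi x by have [/(_ x)/andP[]] := pL.
have [||c1 cc] := @restriction_id phi c => //.
  by move=> x xc; apply: p1; rewrite in_fsupp.
pose near_c m := 0 < measure_integral phi m /\ mdist c (restriction phi m) < e.
have : \forall m \near c, near_c m.
  have cid : {for c, continuous (@id (thickening U))} by exact: cvg_id.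
  have := near_gt0 (continuous_measure_integral L0 pL cid).
  rewrite /= c1 => /(_ ltr01) n1.
  have := near_mdist (continuous_restriction bU L0 pL _ cid) e0.
  rewrite /= c1 cc => /(_ ltr01) n2.
  exact: filterI n1 n2.
move=> /nbhs_ballP[d /= d0 dc].
have dcP m : mdist c m < Num.min d e -> [/\ mdist c m < e,
    0 < measure_integral phi m & mdist c (restriction phi m) < e].
  rewrite lt_min => /andP[cmd cme].
  by have [] : near_c m by apply: dc; rewrite ballEmdist.
exists (Num.min d e); first by rewrite lt_min d0.
have mixI m s : 0 < measure_integral phi m -> 0 <= s <= 1 ->
    mixable s m (restriction phi m).
  move=> m0 s01; have [V' UV' mV'] := meas_supp m.
  apply: (mixable_common _ UV' mV') => // x; rewrite /supp/= mass_restriction//.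
  by move=> mx; apply: mV'; apply: contra mx => /eqP ->; rewrite mulr0 mul0r.
have mixO m s : 0 < measure_integral phi m ->
    mixable (clamp (2 * s - 1)) (mix (clamp (2 * s)) m (restriction phi m)) c.
  move=> m0; have [s2|s2] := leP s (1 / 2).
    by rewrite clamp_le0; [exact: mixable0|lra].
  rewrite (@clamp_ge1 _ (2 * s)); last by lra.
  rewrite mix1; apply: (mixable_common _ UV _ cV); first exact: clamp_itv.
  move=> x; rewrite /supp/= mass_restriction// => mx.
  by apply: pV; apply: contra mx => /eqP ->; rewrite !mul0r.
exists (deform phi c); split=> [m _||s m s01 /dcP[cm m0 cr]|Y b u t cb cu].
- by rewrite /deform mulr0 clamp_le0// clamp_le0 ?mix0//; lra.
- by exists c => m _; rewrite /deform clamp_ge1 ?mix1//; lra.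
- apply: mix_ball_center; [exact: mixO| |by rewrite mdistxx].
  by apply: mix_ball_center => //; apply: mixI => //; exact: clamp_itv.
move=> /dcP[_ m0 _].
have n0 := near_gt0 (continuous_measure_integral L0 pL cu) m0.
have cb1 : {for t, continuous (fun t' => clamp (2 * b t'))}.
  apply: (@continuous_comp _ _ _ (fun t' => 2 * b t') clamp).
    by apply: cvgM; [exact: cvg_cst|exact: cb].
  exact: continuous_clamp.
have cb2 : {for t, continuous (fun t' => clamp (2 * b t' - 1))}.
  apply: (@continuous_comp _ _ _ (fun t' => 2 * b t' - 1) clamp).
    by apply: cvgB; [apply: cvgM; [exact: cvg_cst|exact: cb]|exact: cvg_cst].
  exact: continuous_clamp.
have mI : \forall t' \near t,
    mixable (clamp (2 * b t')) (u t') (restriction phi (u t')).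
  by apply: filterS n0 => t' m0'; apply: mixI => //; exact: clamp_itv.
have mO : \forall t' \near t, mixable (clamp (2 * b t' - 1))
    (mix (clamp (2 * b t')) (u t') (restriction phi (u t'))) c.
  by apply: filterS n0 => t' m0'; exact: mixO.
split=> [|tu].
  apply: continuous_mix => //; last exact: cvg_cst.
  by apply: continuous_mix => //; exact: continuous_restriction pL m0 cu.
apply: tame_mix => //; last exact: tame_cst.
by apply: tame_mix => //; exact: tame_restriction.
Qed.

End Operations.

(** * Moving a map inside disjoint cells *)

Section Moves.
Context {R : realType} {X : metricType R} {U : set (set X)} {Y : topologicalType}.
Implicit Types (u v : Y -> thickening U) (Q : set Y) (b : Y -> R).

(** The two formulas agree near the boundary of [Q], where [b] vanishes and [h 0] is
the identity on the ball in question. *)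
Definition move_cell Q b (h : R -> thickening U -> thickening U) u (t : Y) :
  thickening U := if `[< Q t >] then h (b t) (u t) else u t.

Lemma move_cell_off Q b h u t : ~ Q t -> move_cell Q b h u t = u t.
Proof. by move=> /asboolPn/negbTE; rewrite /move_cell => ->. Qed.

Context (Q : set Y) (b : Y -> R) (h : R -> thickening U -> thickening U)
  (u : Y -> thickening U) (c : thickening U) (d e : R).
Context (hP : contracts c d e h) (cQ : closed Q) (cb : continuous b)
  (bQ : forall t, ~ Q t -> b t = 0) (b01 : forall t, 0 <= b t <= 1)
  (cu : continuous u) (uQ : forall t, Q t -> mdist c (u t) < d).

Let move := move_cell Q b h u.

Lemma move_cell_near t : Q t -> mdist c (move t) < e.
Proof.
move=> Qt; rewrite /move /move_cell asboolT//.
by have [_ _ he _] := hP; apply: he => //; exact: uQ.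
Qed.

Lemma move_cell0 t : b t = 0 -> move t = u t.
Proof.
move=> bt; have [Qt|Qt] := pselect (Q t); last exact: move_cell_off.
by rewrite /move /move_cell asboolT// bt; have [h0 _ _ _] := hP; apply/h0/uQ.
Qed.

Lemma move_cellE t : mdist c (u t) < d -> move t = h (b t) (u t).
Proof.
move=> ct; have [Qt|Qt] := pselect (Q t); first by rewrite /move /move_cell asboolT.
by have [h0 _ _ _] := hP; rewrite bQ// h0//; exact: move_cell_off.
Qed.

Let near_cell t : Q t -> \forall t' \near t, mdist c (u t') < d.
Proof.
move=> /uQ; rewrite -subr_gt0 => d0.
apply: filterS (near_mdist (cu (x := t)) d0) => t' tt'.
by have := metric_triangle c (u t) (u t'); lra.
Qed.

Let near_off t : ~ Q t -> \forall t' \near t, move t' = u t'.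
Proof.
move=> Qt; have : open_nbhs t (~` Q) by split => //; exact: closed_openC.
by move=> /open_nbhs_nbhs; apply: filterS => t'; exact: move_cell_off.
Qed.

Let near_on t : Q t -> \forall t' \near t, move t' = h (b t') (u t').
Proof. by move=> /near_cell; apply: filterS => t'; exact: move_cellE. Qed.

Lemma move_cell_continuous : continuous move.
Proof.
move=> t; have [Qt|Qt] := pselect (Q t); last first.
  rewrite /continuous_at (nbhs_singleton (near_off Qt)).
  apply: cvg_trans (cu (x := t)); apply: near_eq_cvg.
  by near=> t'; rewrite (near (near_off Qt) t').
rewrite /continuous_at (nbhs_singleton (near_on Qt)).
have [_ _ _ /(_ Y b u t)] := hP; move=> /(_ (cb (x := t)) (cu (x := t)) (uQ Qt))[ch _].
apply: cvg_trans ch; apply: near_eq_cvg.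
by near=> t'; rewrite (near (near_on Qt) t').
Unshelve. all: by end_near. Qed.

Lemma move_cell_tame t : tame u t -> tame move t.
Proof.
move=> tu; have [Qt|Qt] := pselect (Q t); last first.
  exact: tame_near_eq (near_off Qt) tu.
have [_ _ _ /(_ Y b u t)] := hP; move=> /(_ (cb (x := t)) (cu (x := t)) (uQ Qt))[_ th].
exact: tame_near_eq (near_on Qt) (th tu).
Qed.

Lemma move_cell_tame1 t : (\forall t' \near t, b t' = 1) -> tame move t.
Proof.
move=> b1; have [_ [c' h1] _ _] := hP.
apply: tame_near_eq (tame_cst c' t); apply: filterS b1 => t' b1.
have Qt' : Q t'.
  by apply: contrapT => /bQ; rewrite b1 => /eqP; rewrite oner_eq0.
by rewrite move_cellE ?uQ// b1 h1// uQ.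
Qed.

End Moves.

Section Deformations.
Context {R : realType} {Y T : topologicalType}.
Implicit Types (u v w : Y -> T) (Z : set Y).

Definition deforms Z u v : Prop := exists G : R * Y -> T,
  [/\ continuous G, forall t, G (0, t) = u t, forall t, G (1, t) = v t &
      forall s t, Z t -> G (s, t) = u t].

Lemma continuous_fst_scale (a b : R) :
  continuous (fun st : R * Y => (clamp (a * st.1 + b), st.2)).
Proof.
apply: continuous_pairing => st; last exact: cvg_snd.
apply: (@continuous_comp _ _ _ (fun st : R * Y => a * st.1 + b) clamp).
  apply: cvgD; last exact: cvg_cst.
  by apply: cvgM; [exact: cvg_cst|exact: cvg_fst].
exact: continuous_clamp.
Qed.

Lemma deforms_refl Z u : continuous u -> deforms Z u u.
Proof.
move=> cu; exists (u \o snd); split=> // st.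
by apply: continuous_comp; [exact: cvg_snd|exact: cu].
Qed.

Lemma deforms_trans Z v u w : deforms Z u v -> deforms Z v w -> deforms Z u w.
Proof.
move=> [G [cG G0 G1 GZ]] [H [cH H0 H1 HZ]].
exists (fun st => if st.1 <= 1 / 2 then G (clamp (2 * st.1 + 0), st.2)
                  else H (clamp (2 * st.1 + -1), st.2)); split => /=.
- apply: continuous_paste => [st|st|st|[s t] /= ->]; first exact: cvg_fst.
  + exact: (continuous_composite (continuous_fst_scale (a := 2) (b := 0)) cG).
  + exact: (continuous_composite (continuous_fst_scale (a := 2) (b := - 1)) cH).
  + by rewrite clamp_ge1 ?G1 ?clamp_le0 ?H0//; lra.
- by move=> t; rewrite ifT; [rewrite clamp_le0 ?G0//|]; lra.
- move=> t; rewrite ifF; last by apply/negbTE; rewrite -ltNge; lra.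
  by rewrite clamp_ge1 ?H1//; lra.
- move=> s t Zt; case: ifP => _; first exact: GZ.
  by rewrite HZ// -G1 GZ.
Qed.

End Deformations.

Section Cells.
Context {R : realType} {X : metricType R} {U : set (set X)} {Y : topologicalType}.
Implicit Types (u v : Y -> thickening U) (Q Z : set Y) (b : Y -> R).

Lemma deforms_move_cell Q b h u c d e Z :
  contracts c d e h -> closed Q -> continuous b ->
  (forall t, ~ Q t -> b t = 0) -> continuous u ->
  (forall t, Q t -> mdist c (u t) < d) -> (forall t, Z t -> b t = 0) ->
  deforms (R := R) Z u (move_cell Q b h u).
Proof.
move=> hP cQ cb bQ cu uQ bZ.
pose Q' : set (R * Y) := snd @^-1` Q; pose b' (st : R * Y) := clamp st.1 * b st.2.
have cs : continuous (snd : R * Y -> Y) by move=> st; exact: cvg_snd.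
have cQ' : closed Q' by apply: closed_comp cQ => st _; exact: cs.
have cb' : continuous b'.
  move=> st; apply: cvgM.
    by apply: continuous_comp; [exact: cvg_fst|exact: continuous_clamp].
  exact: (continuous_composite cs cb).
have bQ' st : ~ Q' st -> b' st = 0 by move=> /bQ bst; rewrite /b' bst mulr0.
have cu' := continuous_composite cs cu.
have uQ' st : Q' st -> mdist c ((u \o snd) st) < d by move=> /uQ.
exists (move_cell Q' b' h (u \o snd)); split.
- exact: move_cell_continuous hP cQ' cb' bQ' cu' uQ'.
- move=> t; rewrite (move_cell0 hP uQ')//.
  by rewrite /b' clamp_le0 ?mul0r.
- by move=> t; rewrite /move_cell /b' /= clamp_ge1// mul1r.
- by move=> s t /bZ bt; rewrite (move_cell0 hP uQ')// /b' bt mulr0.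
Qed.

(** Cells with disjoint supports do not disturb each other, so the moves in all
of them can be made one after the other. *)
Lemma move_disjoint_cells {I : eqType} (l : seq I) (Q : I -> set Y) (b : I -> Y -> R)
    (c : I -> thickening U) d e Z u :
  (forall q, closed (Q q)) -> (forall q, continuous (b q)) ->
  (forall q t, ~ Q q t -> b q t = 0) -> (forall q t, 0 <= b q t <= 1) ->
  (forall q t, Z t -> b q t = 0) ->
  uniq l ->
  {in l &, forall q q' t, Q q t -> Q q' t -> q = q'} ->
  {in l, forall q, exists h, contracts (c q) d e h} ->
  continuous u -> {in l, forall q t, Q q t -> mdist (c q) (u t) < d} ->
  exists v, [/\ continuous v, deforms (R := R) Z u v,
    forall t, v t = u t \/ exists2 q, q \in l & Q q t /\ mdist (c q) (v t) < e,
    forall t, tame u t -> tame v t &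
    {in l, forall q t, (\forall t' \near t, b q t' = 1) -> tame v t}].
Proof.
move=> cQ cb bQ b01 bZ; elim: l u => [|q l IH] u /=.
  move=> _ _ _ cu _; exists u; split=> //; first exact: deforms_refl.
  by move=> t; left.
move=> /andP[ql ul] dl hl cu uQ.
have ql0 : q \in q :: l by exact: mem_head.
have lql q' : q' \in l -> q' \in q :: l by move=> q'l; rewrite inE q'l orbT.
have [h hP] := hl q ql0.
have uQq : forall t, Q q t -> mdist (c q) (u t) < d by exact: uQ.
pose u1 := move_cell (Q q) (b q) h u.
have off t q' : q' \in l -> Q q' t -> ~ Q q t.
  move=> q'l Q't Qt; move: ql.
  by rewrite (dl _ _ ql0 (lql _ q'l) t Qt Q't) q'l.
have cu1 : continuous u1.
  exact: move_cell_continuous hP (cQ q) (cb q) (bQ q) cu uQq.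
have dl1 : {in l &, forall q q' t, Q q t -> Q q' t -> q = q'}.
  by move=> q1 q2 q1l q2l; apply: dl; exact: lql.
have hl1 : {in l, forall q, exists h, contracts (c q) d e h}.
  by move=> q' q'l; exact: hl (lql _ q'l).
have uQ1 : {in l, forall q t, Q q t -> mdist (c q) (u1 t) < d}.
  move=> q' q'l t Qt; rewrite /u1 move_cell_off; last exact: off q'l Qt.
  by apply: uQ => //; exact: lql.
have [v [cv dv vE vt vl]] := IH u1 ul dl1 hl1 cu1 uQ1.
exists v; split=> //.
- apply: deforms_trans dv.
  exact: deforms_move_cell hP (cQ q) (cb q) (bQ q) cu uQq (bZ q).
- move=> t; have [vu|[q' q'l Q't]] := vE t; last first.
    by right; exists q' => //; exact: lql.
  have [Qt|Qt] := pselect (Q q t); last by left; rewrite vu /u1 move_cell_off.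
  right; exists q => //; split => //; rewrite vu.
  exact: move_cell_near hP (b01 q) uQq _ Qt.
- move=> t tu; apply: vt.
  exact: move_cell_tame hP (cQ q) (cb q) (bQ q) cu uQq _ tu.
- move=> q'; rewrite inE => /orP[/eqP -> t b1|q'l t b1]; last exact: vl q'l t b1.
  apply: vt; exact: move_cell_tame1 hP (bQ q) uQq _ b1.
Qed.

End Cells.

Section Contractions.
Context {R : realType} {X : metricType R} {U : set (set X)} {Y : topologicalType}.
Implicit Types (u : Y -> thickening U).

Lemma contracts_shift (c c' : thickening U) d d' e e' h :
  contracts c d e h -> d' + mdist c c' <= d -> e + mdist c c' <= e' ->
  contracts c' d' e' h.
Proof.
move=> [h0 [c1 h1] he hc] dd ee.
have near_c m : mdist c' m < d' -> mdist c m < d.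
  by move=> ?; have := metric_triangle c c' m; lra.
split=> [m /near_c/h0 //||s m s01 /near_c cm|Y' b u t cb cu /near_c].
- by exists c1 => m /near_c/h1.
- have := he s m s01 cm; have := metric_triangle c' c (h s m).
  by rewrite (metric_sym c' c); lra.
- exact: hc.
Qed.

(** A contraction of a ball around [c] serves for all centres close to [c], with
slightly worse radii; compactness does the rest. *)
Lemma uniform_contraction (K : set Y) u e : open_cover U ->
  uniformly_bounded U -> compact K -> continuous u -> 0 < e ->
  exists2 d, 0 < d & forall t, K t -> exists h, contracts (u t) d e h.
Proof.
move=> oU bU /compact_near_coveringP cK cu e0.
have e20 : 0 < e / 2 by rewrite divr_gt0.
have := cK R (0^'+) (fun d t => exists h, contracts (u t) d e h) _.
case=> [t Kt|d /= d0 dK]; last first.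
  have d20 : 0 < d / 2 by rewrite divr_gt0.
  exists (d / 2) => // t Kt; apply: (dK (d / 2)) => //=.
  by rewrite sub0r normrN gtr0_norm//; lra.
have [d d0 [h hP]] := exists_contraction (u t) oU bU e20.
have d20 : 0 < Num.min (d / 2) (e / 2) by rewrite lt_min !divr_gt0.
exists ([set t' | mdist (u t) (u t') < Num.min (d / 2) (e / 2)],
        [set d' | d' < d / 2]).
  split=> /=; first exact: near_mdist (cu t) d20.
  by apply: nbhs_right_lt; rewrite divr_gt0.
move=> [t' d'] /= []; rewrite lt_min => /andP[t1 t2] d'd.
by exists h; apply: contracts_shift hP _ _; lra.
Qed.

End Contractions.

(** * Grids on the cube *)

Section Grid.
Context {R : realType} {N : nat}.
Implicit Types (t : 'rV[R]_N).

Lemma cube_compact : compact (@cube R N).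
Proof.
have := @rV_compact R N (fun=> `[0, 1]%classic) (fun=> @segment_compact _ _ _).
congr compact; apply/seteqP; split=> t /= tP i; have := tP i;
  by rewrite /= in_itv/=.
Qed.

Lemma continuous_coord (i : 'I_N) : continuous (fun t : 'rV[R]_N => t ord0 i).
Proof. exact: coord_continuous. Qed.

Definition parity (m : nat) (q : {ffun 'I_N -> 'I_m.+1}) : {ffun 'I_N -> bool} :=
  [ffun i => odd (q i)].

Section Cell.
Context (m : nat) (q : {ffun 'I_N -> 'I_m.+1}).

Definition grid_point : 'rV[R]_N := \row_i ((q i)%:R / m%:R).

(** In units of the mesh [1 / m], cells have radius 3/4, so that two cells of equal
parity, whose centres differ by at least 2 in some coordinate, are disjoint.
The bump functions are 1 up to radius 5/8, hence near all points at distance at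
most 1/2 from the centre, and such points cover the cube. *)
Definition grid_cell : set 'rV[R]_N :=
  [set t | forall i, `|m%:R * t ord0 i - (q i)%:R| <= 3 / 4].

Definition grid_bump t : R :=
  \prod_i clamp (6 - 8 * `|m%:R * t ord0 i - (q i)%:R|).

Let offset_continuous i :
  continuous (fun t : 'rV[R]_N => `|m%:R * t ord0 i - (q i)%:R|).
Proof.
apply: (continuous_composite (g := fun x : R => `|m%:R * x - (q i)%:R|)
  (@continuous_coord i)) => x.
apply: cvg_norm; apply: cvgB; last exact: cvg_cst.
by apply: cvgM; [exact: cvg_cst|exact: cvg_id].
Qed.

Lemma closed_grid_cell : closed grid_cell.
Proof.
have -> : grid_cell = \bigcap_(i in [set: 'I_N])
    (fun t : 'rV[R]_N => `|m%:R * t ord0 i - (q i)%:R|) @^-1` [set x | x <= 3 / 4].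
  by apply/seteqP; split=> t /= tP i; [move=> _; exact: tP|exact: tP].
apply: closed_bigI => i _; apply: closed_comp; last exact: closed_le.
by move=> t _; exact: offset_continuous.
Qed.

Lemma grid_bump_continuous : continuous grid_bump.
Proof.
apply: continuous_big => [|i _]; first exact: mul_continuous.
apply: (continuous_composite (g := fun x : R => clamp (6 - 8 * x))
  (@offset_continuous i)) => x.
apply: (@continuous_comp _ _ _ (fun x : R => 6 - 8 * x) clamp).
  apply: cvgB; first exact: cvg_cst.
  by apply: cvgM; [exact: cvg_cst|exact: cvg_id].
exact: continuous_clamp.
Qed.

Lemma grid_bump_itv t : 0 <= grid_bump t <= 1.
Proof.
apply/andP; split; first by apply: prodr_ge0 => i _; have /andP[] := clamp_itv
  (6 - 8 * `|m%:R * t ord0 i - (q i)%:R|).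
by apply: prodr_ile1 => i _; exact: clamp_itv.
Qed.

Lemma grid_bump_off t : ~ grid_cell t -> grid_bump t = 0.
Proof.
move=> /existsNP[i /negP]; rewrite -ltNge => ti.
rewrite /grid_bump (bigD1 i)//= clamp_le0 ?mul0r//; lra.
Qed.

Lemma near_grid_bump1 t : (forall i, `|m%:R * t ord0 i - (q i)%:R| <= 1 / 2) ->
  \forall t' \near t, grid_bump t' = 1.
Proof.
move=> tq.
have nq : nbhs t [set t' : 'rV[R]_N | forall i, `|m%:R * t' ord0 i - (q i)%:R| < 5 / 8].
  apply: (near_ord (P := fun (t' : 'rV[R]_N) i =>
    `|m%:R * t' ord0 i - (q i)%:R| < 5 / 8)) => i.
  apply: (near_lt (offset_continuous (i := i))).
  by have := tq i; lra.
apply: (@filterS _ (nbhs t) (nbhs_filter t) _ _ _ nq) => t' t'q.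
rewrite /grid_bump big1// => i _.
by have := t'q i => ?; rewrite clamp_ge1//; lra.
Qed.

Lemma grid_cell_dist t i : (0 < m)%N -> grid_cell t ->
  `|grid_point ord0 i - t ord0 i| < m%:R^-1.
Proof.
move=> m0 /(_ i); have m0' : 0 < m%:R :> R by rewrite ltr0n.
rewrite mxE => tq; rewrite -(ltr_pM2l m0') divff ?gt_eqF//.
rewrite -{1}(gtr0_norm m0') -normrM mulrBr mulrCA divff ?gt_eqF// mulr1 distrC.
by apply: le_lt_trans tq _; lra.
Qed.

Lemma cube_grid_point : (0 < m)%N -> cube grid_point.
Proof.
move=> m0 i; rewrite mxE divr_ge0//= ler_pdivrMr ?ltr0n// mul1r ler_nat.
by rewrite -ltnS.
Qed.

End Cell.

Lemma grid_cell_disjoint m (q q' : {ffun 'I_N -> 'I_m.+1}) t :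
  parity q = parity q' -> grid_cell q t -> grid_cell q' t -> q = q'.
Proof.
move=> pq tq tq'; apply/ffunP => i; apply/val_inj => /=.
have po : odd (q i) = odd (q' i) by have /ffunP/(_ i) := pq; rewrite !ffunE.
have : `|(q i)%:R - (q' i)%:R| < 2 :> R.
  have := tq i; have := tq' i.
  rewrite !ler_norml ltr_norml => /andP[? ?] /andP[? ?]; lra.
rewrite ltr_norml => /andP[l1 l2].
have {}l1 : (q' i < q i + 2)%N by rewrite -(ltr_nat R) natrD; lra.
have {}l2 : (q i < q' i + 2)%N by rewrite -(ltr_nat R) natrD; lra.
lia.
Qed.

Lemma grid_cover m t : (0 < m)%N -> cube t ->
  exists q : {ffun 'I_N -> 'I_m.+1}, forall i, `|m%:R * t ord0 i - (q i)%:R| <= 1 / 2.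
Proof.
move=> m0 ct; pose k i := Num.trunc (m%:R * t ord0 i + 1 / 2).
have kP i : (k i)%:R <= m%:R * t ord0 i + 1 / 2 < (k i).+1%:R.
  apply: truncn_itv => //; have /andP[t0 _] := ct i.
  by rewrite addr_ge0// mulr_ge0.
exists [ffun i => inord (k i)] => i; rewrite ffunE inordK.
  have := kP i; rewrite -[X in _ < X]natr1 => /andP[? ?].
  by rewrite ler_norml; lra.
rewrite -(ltr_nat R) -[X in _ < X]natr1; have /andP[kt _] := kP i.
have /andP[_ t1] := ct i.
have : m%:R * t ord0 i <= m%:R by rewrite ler_piMr.
by lra.
Qed.

End Grid.

(** * Tame approximation *)

Section Approximation.
Context {R : realType} {X : metricType R} {U : set (set X)} {N : nat}.
Context (oU : open_cover U) (bU : uniformly_bounded U).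
Implicit Types (u v : 'rV[R]_N -> thickening U) (t : 'rV[R]_N).

Lemma near_row_ball t (d : R) : 0 < d ->
  nbhs t [set t' : 'rV[R]_N | forall i, `|t ord0 i - t' ord0 i| < d].
Proof.
move=> d0; apply: (near_ord (P := fun (t' : 'rV[R]_N) i =>
  `|t ord0 i - t' ord0 i| < d)) => i.
have cf : continuous (fun t' : 'rV[R]_N => `|t ord0 i - t' ord0 i|).
  apply: (continuous_composite (g := fun x : R => `|t ord0 i - x|)
    (@continuous_coord _ _ i)) => x.
  by apply: cvg_norm; apply: cvgB; [exact: cvg_cst|exact: cvg_id].
by apply: (near_lt cf); rewrite subrr normr0.
Qed.

(** The second point is allowed to lie outside the cube because the cells of the
grid stick out of it. *)
Lemma cube_uniformly_continuous u e : continuous u -> 0 < e ->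
  exists2 d, 0 < d & forall t t', cube t ->
    (forall i, `|t ord0 i - t' ord0 i| < d) -> mdist (u t) (u t') < e.
Proof.
move=> cu e0; have /compact_near_coveringP cK := @cube_compact R N.
have e20 : 0 < e / 2 by rewrite divr_gt0.
have := cK R (0^'+) (fun d t => forall t', (forall i, `|t ord0 i - t' ord0 i| < d) ->
  mdist (u t) (u t') < e) _.
case=> [t _|d /= d0 dK]; last first.
  have d20 : 0 < d / 2 by rewrite divr_gt0.
  exists (d / 2) => // t t' ct; apply: (dK (d / 2)) => //=.
  by rewrite sub0r normrN gtr0_norm//; lra.
have [r r0 rE] : exists2 r, 0 < r & forall t',
    (forall i, `|t ord0 i - t' ord0 i| < r) -> mdist (u t) (u t') < e / 2.
  have := near_mdist (cu t) e20 => -[P Pt Pe].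
  have [r r0 rP] : exists2 r : R, 0 < r & forall i y, `|t ord0 i - y| < r -> P ord0 i y.
    have [||r r0 rP] := @fset_uniform_pos R 'I_N [fset i | i in 'I_N]%fset
      (fun i r => forall y, `|t ord0 i - y| < r -> P ord0 i y).
    - move=> i _; have /nbhs_ballP[r /= r0 rP] := Pt ord0 i.
      by exists r => // y ty; apply: rP.
    - move=> i r r' /andP[r'0 r'r] rP y ty; apply: rP.
      exact: lt_le_trans r'r.
    - by exists r => // i y; apply: rP; rewrite !inE.
  exists r => // t' tt'; apply: Pe => i j; rewrite ord1; apply: rP; exact: tt'.
have r20 : 0 < r / 2 by rewrite divr_gt0.
exists ([set t' : 'rV[R]_N | forall i, `|t ord0 i - t' ord0 i| < r / 2],
        [set d' | d' < r / 2]).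
  by split=> /=; [exact: near_row_ball|exact: nbhs_right_lt].
move=> [s d'] /= [ts d'r] t' st'.
have us : mdist (u t) (u s) < e / 2.
  by apply: rE => i; have := ts i; lra.
have ut' : mdist (u t) (u t') < e / 2.
  apply: rE => i; have := ts i; have := st' i.
  by have := ler_distD (s ord0 i) (t ord0 i) (t' ord0 i); lra.
have := metric_triangle (u s) (u t) (u t').
by rewrite (metric_sym (u s) (u t)); lra.
Qed.

(** One parity class after the other is treated.  The moves of a class keep the map
close to [u] only if it was closer to [u] before, at a scale that depends on the
closeness wanted afterwards.  So the scales are chosen backwards, from the last
class to the first, and the mesh at the end; this is possible because the number
of classes does not depend on the mesh. *)
Lemma move_parity_classes (chi : 'rV[R]_N -> R) u (cs : seq {ffun 'I_N -> bool}) e :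
  continuous chi -> (forall t, 0 <= chi t <= 1) -> continuous u -> 0 < e ->
  exists2 d, 0 < d & exists2 r : R, 0 < r & forall m, (0 < m)%N -> m%:R^-1 < r ->
    forall v, continuous v -> (forall t, mdist (u t) (v t) < d) ->
    exists w, [/\ continuous w, deforms (R := R) [set t | chi t = 0] v w,
      forall t, mdist (u t) (w t) < e,
      forall t, tame v t -> tame w t &
      forall (q : {ffun 'I_N -> 'I_m.+1}) t, parity q \in cs ->
        (\forall t' \near t, grid_bump q t' * chi t' = 1) -> tame w t].
Proof.
move=> cchi chi01 cu; elim: cs e => [|c cs IH] e e0.
  exists e => //; exists 1 => // m m0 _ v cv uv; exists v; split => //.
  exact: deforms_refl.
have [d d0 [r r0 IHd]] := IH e e0.
have d20 : 0 < d / 2 by rewrite divr_gt0.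
have [s s0 sC] := uniform_contraction oU bU (@cube_compact R N) cu d20.
have s20 : 0 < Num.min (s / 2) (d / 2) by rewrite lt_min divr_gt0.
have [r' r'0 ur'] := cube_uniformly_continuous cu s20.
exists (Num.min (s / 2) d); first by rewrite lt_min d0 divr_gt0.
exists (Num.min r r') => [|m m0]; first by rewrite lt_min r0.
rewrite lt_min => /andP[mr mr'] v cv uv.
pose l := [seq q <- enum {ffun 'I_N -> 'I_m.+1} | parity q == c].
pose b (q : {ffun 'I_N -> 'I_m.+1}) (t : 'rV[R]_N) := grid_bump q t * chi t.
have lc q : q \in l -> parity q = c by rewrite mem_filter => /andP[/eqP].
have cb q : continuous (b q).
  move=> t. have cg := @grid_bump_continuous R N m q. exact: (cvgM (cg t) (cchi t)).
have bQ q t : ~ grid_cell q t -> b q t = 0.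
  by move=> /grid_bump_off bt; rewrite /b bt mul0r.
have b01 q t : 0 <= b q t <= 1.
  have /andP[? ?] := grid_bump_itv q t; have /andP[? ?] := chi01 t.
  by rewrite mulr_ge0//= mulr_ile1.
have bZ q t : [set t | chi t = 0] t -> b q t = 0.
  by move=> /= chit; rewrite /b chit mulr0.
have ul : uniq l by rewrite filter_uniq// enum_uniq.
have dl : {in l &, forall q q' t, grid_cell q t -> grid_cell q' t -> q = q'}.
  move=> q q' /lc qc /lc q'c t; apply: grid_cell_disjoint.
  by rewrite qc q'c.
have hl : {in l, forall q, exists h, contracts (u (grid_point q)) s (d / 2) h}.
  by move=> q _; apply: sC; exact: cube_grid_point.
have near_u (q : {ffun 'I_N -> 'I_m.+1}) t : grid_cell q t -> mdist (u (grid_point q)) (u t) <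
    Num.min (s / 2) (d / 2).
  move=> qt; apply: (ur' _ _ (cube_grid_point q m0)) => i.
  exact: (lt_trans (grid_cell_dist i m0 qt) mr').
have vQ : {in l, forall q t, grid_cell q t -> mdist (u (grid_point q)) (v t) < s}.
  move=> q _ t /near_u; have := uv t; rewrite !lt_min => /andP[? ?] /andP[? ?].
  by have := metric_triangle (u (grid_point q)) (u t) (v t); lra.
have [v1 [cv1 dv1 v1E v1t v1l]] := move_disjoint_cells
  (fun q => @closed_grid_cell R N m q) cb bQ b01 bZ ul dl hl cv vQ.
have uv1 t : mdist (u t) (v1 t) < d.
  have [->|[q ql [qt qv]]] := v1E t.
    by have := uv t; rewrite lt_min => /andP[].
  have := near_u _ _ qt; rewrite lt_min => /andP[_ ?].
  have := metric_triangle (u t) (u (grid_point q)) (v1 t).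
  by rewrite (metric_sym (u t) (u (grid_point q))); lra.
have [w [cw dw uw wt wl]] := IHd m m0 mr v1 cv1 uv1.
exists w; split => //; first exact: deforms_trans dv1 dw.
- by move=> t /v1t/wt.
- move=> q t; rewrite inE => /orP[/eqP qc b1|qcs b1]; last exact: wl qcs b1.
  apply: wt; apply: (v1l q) => //.
  by rewrite mem_filter qc eqxx mem_enum.
Qed.

(** Where [chi] is not locally 1 the bump functions times [chi] do not become 1, but
there the map is tame from the beginning, and the moves preserve this. *)
Lemma tame_approximation (chi : 'rV[R]_N -> R) u :
  continuous chi -> (forall t, 0 <= chi t <= 1) -> continuous u ->
  (forall t, cube t -> tame u t \/ \forall t' \near t, chi t' = 1) ->
  exists v, [/\ continuous v, deforms (R := R) [set t | chi t = 0] u v &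
    forall t, cube t -> tame v t].
Proof.
move=> cchi chi01 cu uchi.
have [d d0 [r r0 H]] := move_parity_classes (enum {ffun 'I_N -> bool})
  cchi chi01 cu (@ltr01 R).
pose m := (Num.trunc r^-1).+1.
have mr : m%:R^-1 < r by rewrite invf_plt ?posrE// /m truncnS_gt.
have [|v [cv dv _ vt vl]] := H m isT mr u cu; first by move=> t; rewrite mdistxx.
exists v; split => // t ct; have [/vt//|chi1] := uchi t ct.
have [q qt] := @grid_cover R N m t isT ct.
apply: (vl q); first by rewrite mem_enum.
have b1 := near_grid_bump1 qt.
apply: (@filterS2 _ (nbhs t) (nbhs_filter t) _ _ _ _ b1 chi1) => t' -> ->.
by rewrite mul1r.
Qed.

End Approximation.

(** * Homotopies of cubical loops *)

Section Retracts.
Context {R : realType}.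

Lemma within_retract {Y T : topologicalType} (A : set Y) (r : Y -> Y) (f : Y -> T) :
  continuous r -> (forall y, A (r y)) ->
  {within A, continuous f} -> continuous (f \o r).
Proof.
move=> cr rA /subspace_continuousP cf y W Wf.
have /= := cf _ (rA y) W Wf; rewrite /nbhs/= => /cr; rewrite /nbhs/=.
by apply: filterS => z /= /(_ (rA z)).
Qed.

Lemma retract_within {Y T : topologicalType} (A : set Y) (f g : Y -> T) :
  continuous g -> (forall y, A y -> f y = g y) -> {within A, continuous f}.
Proof.
move=> cg fg; apply: (subspace_eq_continuous (f := g)).
  by move=> y; rewrite inE => Ay; exact/esym/fg.
exact: continuous_subspaceT.
Qed.

Lemma continuous_row {Y : topologicalType} n (f : Y -> 'rV[R]_n) :
  (forall i, continuous (fun y => f y ord0 i)) -> continuous f.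
Proof.
move=> cf y A [P Pf PA].
have : \forall y' \near y, forall i : 'I_n, P ord0 i (f y' ord0 i).
  by apply: near_ord => i; exact: cf (Pf ord0 i).
by apply: filterS => y' Py'; apply: PA => i j; rewrite ord1.
Qed.

Definition clamp_row n (t : 'rV[R]_n) : 'rV[R]_n := \row_i clamp (t ord0 i).

Lemma cube_clamp_row n (t : 'rV[R]_n) : cube (clamp_row t).
Proof. by move=> i; rewrite mxE clamp_itv. Qed.

Lemma clamp_row_id n (t : 'rV[R]_n) : cube t -> clamp_row t = t.
Proof. by move=> ct; apply/rowP => i; rewrite mxE clamp_id. Qed.

Lemma continuous_clamp_row n : continuous (@clamp_row n).
Proof.
apply: continuous_row => i.
under [X in continuous X]funext do rewrite mxE.
exact: (continuous_composite (@continuous_coord _ _ i) continuous_clamp).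
Qed.

End Retracts.

Section Homotopies.
Context {R : realType} {T : topologicalType} {n : nat} (x0 : T).
Implicit Types (u v w : 'rV[R]_n -> T).

Lemma cubical_loopP u : cubical_loop x0 u <->
  continuous (u \o @clamp_row R n) /\ forall t, cube_boundary t -> u t = x0.
Proof.
split=> -[cu bu]; split=> //.
  apply: within_retract cu; [exact: continuous_clamp_row|exact: cube_clamp_row].
by apply: retract_within cu _ => t ct; rewrite /= clamp_row_id.
Qed.

(** Composing with the clamping map turns continuity within the cube into
continuity everywhere, which makes pasting and composing easier. *)
Lemma homotopicP u v : homotopic x0 u v <-> exists G : R * 'rV[R]_n -> T,
  [/\ continuous G, forall t, cube t -> G (0, t) = u t,
      forall t, cube t -> G (1, t) = v t &
      forall s t, cube_boundary t -> G (s, t) = x0].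
Proof.
split=> -[H [cH H0 H1 Hb]]; last first.
  by exists H; split=> //; [exact: continuous_subspaceT|move=> s t _; exact: Hb].
pose r (st : R * 'rV[R]_n) := (clamp st.1, clamp_row st.2).
have cr : continuous r.
  apply: continuous_pairing.
    apply: (continuous_composite (f := fst)); last exact: continuous_clamp.
    by move=> st; exact: cvg_fst.
  apply: (continuous_composite (f := snd)); last exact: continuous_clamp_row.
  by move=> st; exact: cvg_snd.
exists (H \o r); split=> [|t ct|t ct|s t bt]; rewrite /= /r/=.
- apply: within_retract cr _ cH => st; split=> /=; last exact: cube_clamp_row.
  by rewrite in_itv/= clamp_itv.
- by rewrite clamp_le0// clamp_row_id// H0.
- by rewrite clamp_ge1// clamp_row_id// H1.
- by rewrite clamp_row_id ?Hb//; [exact: clamp_itv|case: bt].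
Qed.

Lemma homotopic_refl u : cubical_loop x0 u -> homotopic x0 u u.
Proof.
move=> /cubical_loopP[cu bu]; apply/homotopicP.
exists (u \o @clamp_row R n \o snd); split=> [|t ct|t ct|s t bt] /=.
- by apply: continuous_composite cu => st; exact: cvg_snd.
- by rewrite clamp_row_id.
- by rewrite clamp_row_id.
- by rewrite clamp_row_id ?bu//; case: bt.
Qed.

Lemma homotopic_sym u v : homotopic x0 u v -> homotopic x0 v u.
Proof.
move=> /homotopicP[G [cG G0 G1 Gb]]; apply/homotopicP.
exists (fun st => G (1 - st.1, st.2)); split=> [|t ct|t ct|s t bt] /=.
- apply: (continuous_composite (f := fun st : R * 'rV[R]_n => (1 - st.1, st.2))) cG.
  apply: continuous_pairing => st; last exact: cvg_snd.
  by apply: cvgB; [exact: cvg_cst|exact: cvg_fst].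
- by rewrite subr0 G1.
- by rewrite subrr G0.
- exact: Gb.
Qed.

Lemma homotopic_trans v u w :
  homotopic x0 u v -> homotopic x0 v w -> homotopic x0 u w.
Proof.
move=> /homotopicP[G [cG G0 G1 Gb]] /homotopicP[H [cH H0 H1 Hb]].
apply/homotopicP.
have cr a b : continuous (fun st : R * 'rV[R]_n =>
    (clamp (a * st.1 + b), clamp_row st.2)).
  apply: (continuous_composite (continuous_fst_scale (a := a) (b := b))
    (g := fun st : R * 'rV[R]_n => (st.1, clamp_row st.2))).
  apply: continuous_pairing; first by move=> st; exact: cvg_fst.
  apply: (continuous_composite (f := snd)); last exact: continuous_clamp_row.
  by move=> st; exact: cvg_snd.
exists (fun st => if st.1 <= 1 / 2 then G (clamp (2 * st.1 + 0), clamp_row st.2)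
                  else H (clamp (2 * st.1 + -1), clamp_row st.2)); split => /=.
- apply: continuous_paste => [st|||[s t] /= ->]; first exact: cvg_fst.
  + exact: (continuous_composite (cr 2 0) cG).
  + exact: (continuous_composite (cr 2 (- 1)) cH).
  + have ct := @cube_clamp_row R n t.
    by rewrite clamp_ge1 ?G1 ?clamp_le0 ?H0//; lra.
- move=> t ct; rewrite ifT; last by lra.
  by rewrite clamp_le0 ?clamp_row_id ?G0//; lra.
- move=> t ct; rewrite ifF; last by apply/negbTE; rewrite -ltNge; lra.
  by rewrite clamp_ge1 ?clamp_row_id ?H1//; lra.
- move=> s t bt; rewrite clamp_row_id; last by case: bt.
  by case: ifP => _; [exact: Gb|exact: Hb].
Qed.

Lemma homotopy_class_eq u v : homotopic x0 u v ->
  homotopy_class x0 u = homotopy_class x0 v.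
Proof.
move=> uv; apply/seteqP; split=> w [lw h]; split=> //.
  exact: homotopic_trans (homotopic_sym uv) h.
exact: homotopic_trans uv h.
Qed.

Lemma homotopy_class_inj u v : cubical_loop x0 v ->
  homotopy_class x0 u = homotopy_class x0 v -> homotopic x0 u v.
Proof.
move=> lv uv; have : homotopy_class x0 v v by split=> //; exact: homotopic_refl.
by rewrite -uv => -[].
Qed.

Definition collar (t : 'rV[R]_n) : 'rV[R]_n := \row_i clamp (3 * t ord0 i - 1).

Lemma cube_collar t : cube (collar t).
Proof. by move=> i; rewrite mxE clamp_itv. Qed.

Lemma collar_boundary (t : 'rV[R]_n) i : t ord0 i <= 1 / 3 \/ 2 / 3 <= t ord0 i ->
  cube_boundary (collar t).
Proof.
move=> ti; split; first exact: cube_collar.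
exists i; rewrite mxE; case: ti => ti; [left|right].
  by rewrite clamp_le0//; lra.
by rewrite clamp_ge1//; lra.
Qed.

Lemma continuous_affine (a b : R) : continuous (fun x : R => a * x + b).
Proof.
move=> x; apply: cvgD; last exact: cvg_cst.
by apply: cvgM; [exact: cvg_cst|exact: cvg_id].
Qed.

Lemma continuous_collar : continuous collar.
Proof.
apply: continuous_row => i.
under [X in continuous X]funext do rewrite mxE.
apply: (continuous_composite (g := fun x : R => clamp (3 * x + -1))
  (@continuous_coord _ _ i)).
exact: (continuous_composite (@continuous_affine 3 (-1)) continuous_clamp).
Qed.

Lemma continuous_loop_collar u : cubical_loop x0 u -> continuous (u \o collar).
Proof.
move=> /cubical_loopP[cu _].
have -> : u \o collar = (u \o @clamp_row R n) \o collar.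
  by apply/funext => t /=; rewrite clamp_row_id//; exact: cube_collar.
exact: continuous_composite continuous_collar cu.
Qed.

(** The cube is stretched from its centre by factors from 1 to 3 and clamped, and
its boundary stays in the boundary meanwhile.  In the end the points with a
coordinate at most 1/3 or at least 2/3 go to the boundary. *)
Lemma homotopic_collar u : cubical_loop x0 u -> homotopic x0 u (u \o collar).
Proof.
move=> /cubical_loopP[cu bu]; apply/homotopicP.
pose r (st : R * 'rV[R]_n) : 'rV[R]_n :=
  \row_i clamp ((1 + 2 * st.1) * st.2 ord0 i - st.1).
have cr : continuous r.
  apply: continuous_row => i.
  under [X in continuous X]funext do rewrite mxE.
  apply: (continuous_composite _ continuous_clamp) => st.
  apply: cvgB; last exact: cvg_fst.
  apply: cvgM.
    apply: cvgD; first exact: cvg_cst.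
    by apply: cvgM; [exact: cvg_cst|exact: cvg_fst].
  apply: (continuous_composite (f := snd) (g := fun t : 'rV[R]_n => t ord0 i)).
    by move=> ?; exact: cvg_snd.
  exact: continuous_coord.
have rc st : cube (r st) by move=> i; rewrite mxE clamp_itv.
exists (u \o @clamp_row R n \o (fun st => r (clamp st.1, st.2))).
split=> [|t ct|t ct|s t bt] /=.
- apply: continuous_composite cu; apply: continuous_composite cr.
  apply: continuous_pairing; last by move=> ?; exact: cvg_snd.
  apply: (continuous_composite _ continuous_clamp) => st; exact: cvg_fst.
- rewrite clamp_row_id//; congr u; apply/rowP => i; rewrite mxE/=.
  by rewrite (@clamp_le0 _ 0)// mulr0 addr0 mul1r subr0 clamp_id.
- rewrite clamp_row_id//; congr u; apply/rowP => i; rewrite !mxE/=.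
  by rewrite (@clamp_ge1 _ 1)//; congr clamp; ring.
- rewrite clamp_row_id//; apply: bu; split; first exact: rc.
  have [ct [i ti]] := bt; exists i; rewrite mxE/=.
  have /andP[s0 s1] := clamp_itv s.
  case: ti => ->; [left|right].
    by rewrite clamp_le0// mulr0 sub0r oppr_le0.
  by rewrite clamp_ge1//; lra.
Qed.

End Homotopies.

Section Concatenation.
Context {R : realType} {T : topologicalType} {n : nat} (x0 : T).
Implicit Types (u v : 'rV[R]_n.+1 -> T) (t : 'rV[R]_n.+1).

(** The reparametrizations in [loop_concat], clamped so that both branches are
defined on the whole space. *)
Definition half_coord (b : R) t : 'rV[R]_n.+1 :=
  clamp_row (set_coord0 t (2 * t ord0 ord0 + b)).

Lemma continuous_half_coord b : continuous (half_coord b).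
Proof.
apply: (continuous_composite _ (@continuous_clamp_row _ _)).
apply: continuous_row => i; have [->|i0] := eqVneq i ord0; last first.
  under [X in continuous X]funext do rewrite mxE (negbTE i0).
  exact: continuous_coord.
under [X in continuous X]funext do rewrite mxE eqxx.
exact: (continuous_composite (@continuous_coord _ _ ord0) (@continuous_affine _ 2 b)).
Qed.

Lemma half_coordE b t : cube t -> 0 <= 2 * t ord0 ord0 + b <= 1 ->
  half_coord b t = set_coord0 t (2 * t ord0 ord0 + b).
Proof.
by move=> ct b01; apply: clamp_row_id => i; rewrite mxE; case: ifP.
Qed.

Lemma half_coord_boundary b t : 2 * t ord0 ord0 + b = 0 \/ 2 * t ord0 ord0 + b = 1 ->
  cube_boundary (half_coord b t).
Proof.
move=> bt; split; first exact: cube_clamp_row.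
exists ord0; rewrite !mxE eqxx; case: bt => ->; [left|right].
  exact: clamp_le0.
exact: clamp_ge1.
Qed.

Lemma loop_concat_boundary u v t : cubical_loop x0 u -> cubical_loop x0 v ->
  cube_boundary t -> loop_concat u v t = x0.
Proof.
move=> [_ bu] [_ bv] [ct [i ti]].
have bc s : 0 <= s <= 1 -> (i = ord0 -> s = 0 \/ s = 1) ->
    cube_boundary (set_coord0 t s).
  move=> s01 si; split; first by move=> j; rewrite mxE; case: ifP.
  have [i0|i0] := eqVneq i ord0; first by exists ord0; rewrite mxE eqxx; exact: si.
  by exists i; rewrite mxE (negbTE i0).
have /andP[t0 t1] := ct ord0; rewrite /loop_concat.
case: ifP => t2; [apply: bu|apply: bv]; apply: bc.
- by apply/andP; split; lra.
- by move=> i0; move: ti; rewrite i0 => -[t00|t01]; [left|exfalso]; lra.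
- by move/negbT: t2; rewrite -ltNge => t2; apply/andP; split; lra.
- move/negbT: t2; rewrite -ltNge => t2.
  by move=> i0; move: ti; rewrite i0 => -[t00|t01]; [exfalso|right]; lra.
Qed.

(** Concatenation with parameters: [Y] is the time axis when homotopies are
concatenated. *)
Lemma concat_homotopy (Y : topologicalType) (G H : Y * 'rV[R]_n.+1 -> T) :
  continuous G -> continuous H ->
  (forall y t, cube_boundary t -> G (y, t) = x0) ->
  (forall y t, cube_boundary t -> H (y, t) = x0) ->
  exists K : Y * 'rV[R]_n.+1 -> T, continuous K /\ forall y t, cube t ->
    K (y, t) = loop_concat (fun t => G (y, t)) (fun t => H (y, t)) t.
Proof.
move=> cG cH bG bH.
have cr b : continuous (fun yt : Y * 'rV[R]_n.+1 => (yt.1, half_coord b yt.2)).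
  apply: continuous_pairing; first by move=> yt; exact: cvg_fst.
  apply: (continuous_composite (f := snd)); last exact: continuous_half_coord.
  by move=> yt; exact: cvg_snd.
exists (fun yt : Y * 'rV[R]_n.+1 => if yt.2 ord0 ord0 <= 2^-1 then G (yt.1, half_coord 0 yt.2)
                  else H (yt.1, half_coord (-1) yt.2)); split.
  apply: (continuous_paste (a := fun yt : Y * 'rV[R]_n.+1 => yt.2 ord0 ord0)).
  - apply: (continuous_composite (f := snd) (g := fun t => t ord0 ord0)).
      by move=> yt; exact: cvg_snd.
    exact: continuous_coord.
  - exact: (continuous_composite (cr 0) cG).
  - exact: (continuous_composite (cr (-1)) cH).
  - move=> [y t] /= t2; rewrite bG; last first.
      by apply: half_coord_boundary; right; rewrite t2; lra.
    by rewrite bH//; apply: half_coord_boundary; left; rewrite t2; lra.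
move=> y t ct; have /andP[t0 t1] := ct ord0; rewrite /loop_concat/=.
case: ifP => t2; rewrite half_coordE ?addr0//.
  by apply/andP; split; lra.
by move/negbT: t2; rewrite -ltNge => t2; apply/andP; split; lra.
Qed.

Lemma cubical_loop_concat u v : cubical_loop x0 u -> cubical_loop x0 v ->
  cubical_loop x0 (loop_concat u v).
Proof.
move=> lu lv; split; last by move=> t; exact: loop_concat_boundary.
have [cu bu] := (cubical_loopP _ _).1 lu; have [cv bv] := (cubical_loopP _ _).1 lv.
have cs : continuous (snd : R * 'rV[R]_n.+1 -> _) by move=> ?; exact: cvg_snd.
have [||K [cK KE]] := concat_homotopy (continuous_composite cs cu)
  (continuous_composite cs cv).
- by move=> y t [ct bt]; rewrite /= clamp_row_id// bu.
- by move=> y t [ct bt]; rewrite /= clamp_row_id// bv.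
have cK' : continuous (fun t => K (0 : R, t)).
  exact: continuous_composite (@continuous_slice _ _ (0 : R)) cK.
apply: retract_within cK' _ => t ct; rewrite KE// /loop_concat /=.
have /andP[t0 t1] := ct ord0.
case: ifP => t2; rewrite clamp_row_id// => i; rewrite mxE; case: ifP => // _.
  by apply/andP; split; lra.
by move/negbT: t2; rewrite -ltNge => t2; apply/andP; split; lra.
Qed.

Lemma homotopic_concat u u' v v' : homotopic x0 u u' -> homotopic x0 v v' ->
  homotopic x0 (loop_concat u v) (loop_concat u' v').
Proof.
move=> /homotopicP[G [cG G0 G1 Gb]] /homotopicP[H [cH H0 H1 Hb]].
have [K [cK KE]] := concat_homotopy cG cH Gb Hb.
have cc t s : cube t -> 0 <= s <= 1 -> cube (set_coord0 t s).
  by move=> ct s01 i; rewrite mxE; case: ifP.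
have loopE a b w w' : (forall t, cube t -> G (a, t) = w t) ->
    (forall t, cube t -> H (b, t) = w' t) -> forall t, cube t ->
    loop_concat (fun t => G (a, t)) (fun t => H (b, t)) t = loop_concat w w' t.
  move=> Gw Hw t ct; have /andP[t0 t1] := ct ord0; rewrite /loop_concat.
  case: ifP => t2; [apply: Gw|apply: Hw]; apply: cc => //.
    by apply/andP; split; lra.
  by move/negbT: t2; rewrite -ltNge => t2; apply/andP; split; lra.
apply/homotopicP; exists K; split=> // [t ct|t ct|s t bt].
- by rewrite KE//; exact: loopE.
- by rewrite KE//; exact: loopE.
- rewrite KE; last by case: bt.
  have lx (w : 'rV[R]_n.+1 -> T) : (forall t, cube_boundary t -> w t = x0) ->
    continuous w -> cubical_loop x0 w.
    by move=> bw cw; split=> //; exact: continuous_subspaceT.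
  have cs := @continuous_slice 'rV[R]_n.+1 _ s.
  apply: loop_concat_boundary bt; apply: lx.
  + by move=> t'; exact: Gb.
  + exact: continuous_composite cs cG.
  + by move=> t'; exact: Hb.
  + exact: continuous_composite cs cH.
Qed.

Lemma homotopy_mul_class u v : cubical_loop x0 u -> cubical_loop x0 v ->
  homotopy_mul x0 (homotopy_class x0 u) (homotopy_class x0 v) =
  homotopy_class x0 (loop_concat u v).
Proof.
move=> lu lv; apply/seteqP; split=> [w [u' [lu' uu'] [v' [lv' vv'] ww]]|w ww].
  by rewrite (homotopy_class_eq (homotopic_concat uu' vv')).
exists u; first by split=> //; exact: homotopic_refl.
by exists v => //; split=> //; exact: homotopic_refl.
Qed.

End Concatenation.

Section InducedMaps.
Context {R : realType} {S T : topologicalType} (f : S -> T) (cf : continuous f).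

Lemma cubical_loop_comp n (x0 : S) (u : 'rV[R]_n -> S) : cubical_loop x0 u ->
  cubical_loop (f x0) (f \o u).
Proof.
move=> /cubical_loopP[cu bu]; apply/cubical_loopP; split.
  exact: continuous_composite cu cf.
by move=> t /bu /= ->.
Qed.

Lemma homotopic_comp n (x0 : S) (u v : 'rV[R]_n -> S) : homotopic x0 u v ->
  homotopic (f x0) (f \o u) (f \o v).
Proof.
move=> /homotopicP[G [cG G0 G1 Gb]]; apply/homotopicP; exists (f \o G).
split=> [|t ct|t ct|s t bt] /=.
- exact: continuous_composite cG cf.
- by rewrite G0.
- by rewrite G1.
- by rewrite Gb.
Qed.

Lemma homotopy_map_class n (x0 : S) (u : 'rV[R]_n -> S) : cubical_loop x0 u ->
  homotopy_map f x0 (homotopy_class x0 u) = homotopy_class (f x0) (f \o u).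
Proof.
move=> lu; apply/seteqP; split=> [w [u' [lu' uu'] h]|w h].
  by rewrite (homotopy_class_eq (homotopic_comp uu')).
by exists u => //; split=> //; exact: homotopic_refl.
Qed.

(** The map induced on homotopy classes commutes with concatenation already at
the level of loops. *)
Lemma homotopy_map_mul n (x0 : S) :
  {in @homotopy_group R S n.+1 x0 &, {morph @homotopy_map R S T f n.+1 x0 :
    C D / homotopy_mul x0 C D >-> homotopy_mul (f x0) C D}}.
Proof.
move=> C D; rewrite !inE => -[u lu <-] [v lv <-].
have [lfu lfv] := (cubical_loop_comp lu, cubical_loop_comp lv).
rewrite !homotopy_map_class// !homotopy_mul_class// homotopy_map_class.
  by congr homotopy_class; apply/funext => t; rewrite /= /loop_concat; case: ifP.
exact: cubical_loop_concat.
Qed.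

End InducedMaps.

Section PathComponents.
Context {R : realType} {T : topologicalType}.

(** The cube of dimension 0 is a point without boundary, so homotopies of loops in
dimension 0 are paths, whatever the base point. *)
Lemma joined_homotopic (x0 x y : T) :
  joined R x y <-> @homotopic R T 0 x0 (cst x) (cst y).
Proof.
split=> [[p [cp p0 p1]]|/homotopicP[G [cG G0 G1 Gb]]].
  apply/homotopicP; exists (p \o clamp \o fst); split=> [|t _|t _|s t [_ [[]//]]].
  - apply: (continuous_composite (f := fst)); first by move=> ?; exact: cvg_fst.
    apply: within_retract cp; first exact: continuous_clamp.
    by move=> s; rewrite /= in_itv/= clamp_itv.
  - by rewrite /= clamp_le0.
  - by rewrite /= clamp_ge1.
have c0 : @cube R 0 0 by case.
exists (fun s => G (s, 0)); split; [|exact: G0|exact: G1].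
apply: continuous_subspaceT; apply: (continuous_composite _ cG).
by apply: continuous_pairing; [move=> s; exact: cvg_id|exact: cst_continuous].
Qed.

Lemma cubical_loop0 (x0 x : T) : @cubical_loop R T 0 x0 (cst x).
Proof.
split=> [|t [_ [[]//]]].
by apply: continuous_subspaceT; exact: cst_continuous.
Qed.

Lemma joined_refl (x : T) : joined R x x.
Proof. by apply/(joined_homotopic x)/homotopic_refl/cubical_loop0. Qed.

Lemma joined_class_eq (x y : T) : joined R x y ->
  [set z | joined R x z] = [set z | joined R y z].
Proof.
move=> /(joined_homotopic x) xy; apply/seteqP; split=> z /= /(joined_homotopic x) h;
  apply/(joined_homotopic x).
  exact: homotopic_trans (homotopic_sym xy) h.
exact: homotopic_trans xy h.
Qed.

End PathComponents.

(** * The natural map *)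

Section Interior.
Context {R : realType} {N : nat}.
Implicit Types t : 'rV[R]_N.

(** This function is 1 where all coordinates lie between 1/4 and 3/4.  The
interior of this region and the points with a coordinate less than 1/3 or
greater than 2/3, which [collar] sends to the boundary, cover the space. *)
Definition interior_cutoff t : R :=
  \prod_i (clamp (4 * t ord0 i) * clamp (4 * (1 - t ord0 i))).

Lemma interior_cutoff_itv t : 0 <= interior_cutoff t <= 1.
Proof.
have c01 i : 0 <= clamp (4 * t ord0 i) * clamp (4 * (1 - t ord0 i)) <= 1.
  have /andP[? ?] := clamp_itv (4 * t ord0 i).
  have /andP[? ?] := clamp_itv (4 * (1 - t ord0 i)).
  by rewrite mulr_ge0//= mulr_ile1.
apply/andP; split; first by apply: prodr_ge0 => i _; have /andP[] := c01 i.
by apply: prodr_ile1 => i _; exact: c01.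
Qed.

Lemma interior_cutoff_continuous : continuous interior_cutoff.
Proof.
apply: continuous_big => [|i _]; first exact: mul_continuous.
apply: (continuous_composite
  (g := fun x : R => clamp (4 * x) * clamp (4 * (1 - x)))
  (@continuous_coord _ _ i)) => x.
apply: cvgM.
  apply: (@continuous_comp _ _ _ (fun x : R => 4 * x) clamp).
    by apply: cvgM; [exact: cvg_cst|exact: cvg_id].
  exact: continuous_clamp.
apply: (@continuous_comp _ _ _ (fun x : R => 4 * (1 - x)) clamp).
  apply: cvgM; first exact: cvg_cst.
  by apply: cvgB; [exact: cvg_cst|exact: cvg_id].
exact: continuous_clamp.
Qed.

Lemma interior_cutoff_boundary t : cube_boundary t -> interior_cutoff t = 0.
Proof.
move=> [_ [i ti]]; rewrite /interior_cutoff (bigD1 i)//=.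
case: ti => ->; first by rewrite mulr0 (@clamp_le0 _ 0)// !mul0r.
by rewrite subrr mulr0 (@clamp_le0 _ 0)// mulr0 mul0r.
Qed.

Lemma near_coord_lt t i c : t ord0 i < c -> nbhs t [set t' : 'rV[R]_N | t' ord0 i < c].
Proof. exact: (near_lt (f := fun t : 'rV[R]_N => t ord0 i) (@continuous_coord _ _ i)). Qed.

Lemma near_coord_gt t i c : c < t ord0 i -> nbhs t [set t' : 'rV[R]_N | c < t' ord0 i].
Proof.
move=> ct; have cN : continuous (fun t' : 'rV[R]_N => - t' ord0 i).
  apply: (continuous_composite (g := fun x : R => - x) (@continuous_coord _ _ i)).
  exact: opp_continuous.
have : nbhs t [set t' : 'rV[R]_N | - t' ord0 i < - c].
  by apply: (near_lt cN); rewrite ltrN2.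
by apply: (@filterS _ (nbhs t) (nbhs_filter t)) => t' /=; rewrite ltrN2.
Qed.

Lemma near_boundary_or_cutoff t :
  [\/ exists i, nbhs t [set t' : 'rV[R]_N | t' ord0 i <= 1 / 3],
      exists i, nbhs t [set t' : 'rV[R]_N | 2 / 3 <= t' ord0 i] |
      nbhs t [set t' : 'rV[R]_N | interior_cutoff t' = 1]].
Proof.
have [[i ti]|lo] := pselect (exists i, t ord0 i < 1 / 3).
  constructor 1; exists i.
  by apply: (@filterS _ (nbhs t) (nbhs_filter t) _ _ _ (near_coord_lt ti)) => t' /ltW.
have [[i ti]|hi] := pselect (exists i, 2 / 3 < t ord0 i).
  constructor 2; exists i.
  by apply: (@filterS _ (nbhs t) (nbhs_filter t) _ _ _ (near_coord_gt ti)) => t' /ltW.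
constructor 3.
have n1 : nbhs t [set t' : 'rV[R]_N | forall i, t' ord0 i < 3 / 4].
  apply: (near_ord (P := fun (t' : 'rV[R]_N) i => t' ord0 i < 3 / 4)) => i.
  apply: near_coord_lt; have : ~ 2 / 3 < t ord0 i by move=> ?; apply: hi; exists i.
  by move/negP; rewrite -leNgt; lra.
have n2 : nbhs t [set t' : 'rV[R]_N | forall i, 1 / 4 < t' ord0 i].
  apply: (near_ord (P := fun (t' : 'rV[R]_N) i => 1 / 4 < t' ord0 i)) => i.
  apply: near_coord_gt; have : ~ t ord0 i < 1 / 3 by move=> ?; apply: lo; exists i.
  by move/negP; rewrite -leNgt; lra.
apply: (@filterS2 _ (nbhs t) (nbhs_filter t) _ _ _ _ n1 n2) => t' l1 l2.
rewrite /= /interior_cutoff big1// => i _.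
have := l1 i; have := l2 i => ? ?.
by rewrite !clamp_ge1 ?mulr1//; lra.
Qed.

End Interior.

Section Main.
Context {R : realType} {X : metricType R} {U : set (set X)}.
Context (oU : open_cover U) (bU : uniformly_bounded U).
Let f := @natural_map R X U.

Lemma tame_within N (A : set 'rV[R]_N) (v : 'rV[R]_N -> thickening U) :
  (forall t, A t -> tame v t) -> {within A, continuous (realize \o v)}.
Proof.
move=> tv; apply: continuous_in_subspaceT => t; rewrite inE => /tv.
exact: tame_continuous.
Qed.

(** After composition with [collar] the loop is constant, hence tame, near the
boundary, and it can be deformed relative to the boundary into a tame map. *)
Lemma loop_tame_approximation n (x0 : realization U)
    (w : 'rV[R]_n -> thickening U) : cubical_loop (f x0) w ->
  exists2 u, cubical_loop x0 u & homotopic (f x0) (f \o u) w.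
Proof.
move=> lw; have cw := continuous_loop_collar lw; have [_ bw] := lw.
have [|v [cv [G [cG G0 G1 GZ]] tv]] := tame_approximation oU bU
  (@interior_cutoff_continuous R n) (@interior_cutoff_itv R n) cw.
  move=> t _; have bt (P : 'rV[R]_n -> Prop) : nbhs t P ->
      (forall t', P t' -> cube_boundary (collar t')) -> tame (w \o @collar R n) t.
    move=> nP Pb; apply: (tame_near_eq _ (tame_cst (f x0) t)).
    by apply: (@filterS _ (nbhs t) (nbhs_filter t) _ _ _ nP) => t' /Pb/bw.
  have [[i ti]|[i ti]|?] := near_boundary_or_cutoff t; last by right.
    by left; apply: bt ti _ => t' ?; apply: (collar_boundary (i := i)); left.
  by left; apply: bt ti _ => t' ?; apply: (collar_boundary (i := i)); right.
have fr : f \o (realize \o v) = v by apply/funext => t /=; rewrite /f realizeK.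
have bc t : cube_boundary t -> w (collar t) = f x0.
  move=> [ct [i ti]]; apply: bw; apply: (collar_boundary (i := i)).
  by case: ti => ->; [left|right]; lra.
exists (realize \o v).
  split; first exact: tame_within.
  move=> t bt /=; rewrite -G1 GZ; last exact: interior_cutoff_boundary.
  by rewrite /= bc// /f natural_mapK.
rewrite fr; apply: (homotopic_trans (v := w \o @collar R n)); last first.
  exact/homotopic_sym/homotopic_collar.
apply: homotopic_sym; apply/homotopicP; exists G; split => // s t bt.
by rewrite GZ; [exact: bc|exact: interior_cutoff_boundary].
Qed.

(** A homotopy between loops of the realization is weakly continuous at its ends
already.  Made constant in time near both ends and equal to the base point near
the other faces, it is tame near the boundary of the cube of one more dimension,
so it can be replaced by a tame map with the same values on the boundary. *)
Lemma natural_map_homotopic_inj n (x0 : realization U)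
    (u v : 'rV[R]_n -> realization U) : cubical_loop x0 u -> cubical_loop x0 v ->
  homotopic (f x0) (f \o u) (f \o v) -> homotopic x0 u v.
Proof.
move=> lu lv /homotopicP[G [cG G0 G1 Gb]].
(* Coordinate 0 of the larger cube is time; [K] is the identification, and [J]
   is its inverse followed by the collar maps in time and space. *)
pose J (x : 'rV[R]_n.+1) : R * 'rV[R]_n :=
  (clamp (3 * x ord0 ord0 - 1), collar (\row_i x ord0 (lift ord0 i))).
pose K (st : R * 'rV[R]_n) : 'rV[R]_n.+1 :=
  \row_j (if unlift ord0 j is Some i then st.2 ord0 i else st.1).
have K0 st : K st ord0 ord0 = st.1 by rewrite mxE unlift_none.
have KS st i : K st ord0 (lift ord0 i) = st.2 ord0 i by rewrite mxE liftK.
have cK : continuous K.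
  apply: continuous_row => j; case: (unliftP ord0 j) => [i ->|->].
    under [X in continuous X]funext do rewrite KS.
    apply: (continuous_composite (f := snd) (g := fun t : 'rV[R]_n => t ord0 i)).
      by move=> ?; exact: cvg_snd.
    exact: continuous_coord.
  under [X in continuous X]funext do rewrite K0.
  by move=> ?; exact: cvg_fst.
have cT : continuous (fun x : 'rV[R]_n.+1 => collar (\row_i x ord0 (lift ord0 i))).
  apply: (continuous_composite _ (@continuous_collar _ _)).
  apply: continuous_row => i; under [X in continuous X]funext do rewrite mxE.
  exact: continuous_coord.
have cJ : continuous J.
  apply: continuous_pairing cT.
  apply: (continuous_composite (g := fun x : R => clamp (3 * x + -1))
    (@continuous_coord _ _ ord0)).
  exact: (continuous_composite (@continuous_affine _ 3 (-1)) continuous_clamp).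
have cw := continuous_composite cJ cG.
have tame_end (y : 'rV[R]_n -> realization U) (x : 'rV[R]_n.+1) :
    cubical_loop x0 y -> tame (f \o (y \o snd \o J)) x.
  move=> ly; apply: continuous_tame.
  have -> : y \o snd \o J = (y \o @collar R n) \o
      (fun x : 'rV[R]_n.+1 => \row_i x ord0 (lift ord0 i)) by [].
  apply: (continuous_composite _ (continuous_loop_collar ly)).
  apply: continuous_row => i; under [X in continuous X]funext do rewrite mxE.
  exact: continuous_coord.
have [|w [cw' [H [cH H0 H1 HZ]] tw]] := tame_approximation oU bU
  (@interior_cutoff_continuous R n.+1) (@interior_cutoff_itv R n.+1) cw.
  move=> x _; have nF := nbhs_filter x.
  have bt (P : 'rV[R]_n.+1 -> Prop) i : nbhs x P ->
      (forall x' : 'rV[R]_n.+1, P x' -> x' ord0 (lift ord0 i) <= 1 / 3 \/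
         2 / 3 <= x' ord0 (lift ord0 i)) -> tame (G \o J) x.
    move=> nP Pb; apply: (tame_near_eq _ (tame_cst (f x0) x)).
    apply: (@filterS _ (nbhs x) nF _ _ _ nP) => x' /Pb xi.
    by rewrite /= /J Gb//; apply: (collar_boundary (i := i)); rewrite mxE.
  have [[i xi]|[i xi]|?] := near_boundary_or_cutoff x; last by right.
    left; case: (unliftP ord0 i) xi => [j ->|->] xi.
      by apply: (bt _ j xi) => x' ?; left.
    apply: (tame_near_eq _ (tame_end u x lu)).
    apply: (@filterS _ (nbhs x) nF _ _ _ xi) => x' /= xi'.
    by rewrite /= /J clamp_le0; [rewrite G0//; exact: cube_collar|lra].
  left; case: (unliftP ord0 i) xi => [j ->|->] xi.
    by apply: (bt _ j xi) => x' ?; right.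
  apply: (tame_near_eq _ (tame_end v x lv)).
  apply: (@filterS _ (nbhs x) nF _ _ _ xi) => x' /= xi'.
  by rewrite /= /J clamp_ge1; [rewrite G1//; exact: cube_collar|lra].
have wE x : cube_boundary x -> w x = G (J x).
  by move=> bx; rewrite -H1 HZ//; exact: interior_cutoff_boundary.
have cubeK s t : 0 <= s <= 1 -> cube t -> cube (K (s, t)).
  by move=> s01 ct j; case: (unliftP ord0 j) => [i ->|->]; rewrite ?KS ?K0.
have JK s t : J (K (s, t)) = (clamp (3 * s - 1), collar t).
  rewrite /J K0/=; congr (_, collar _); apply/rowP => i; rewrite mxE; exact: KS.
suff uv : homotopic x0 (u \o @collar R n) (v \o @collar R n).
  apply: homotopic_trans (homotopic_collar lu) _.
  exact: homotopic_trans uv (homotopic_sym (homotopic_collar lv)).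
exists (realize \o w \o K); split.
- apply: continuous_in_subspaceT => -[s t]; rewrite inE/= in_itv/= => -[s01 ct].
  apply: (@continuous_comp _ _ _ K (realize \o w)); first exact: cK.
  by apply: tame_continuous; apply: tw; exact: cubeK.
- move=> t ct /=; rewrite wE; last first.
    split; first by apply: cubeK => //; rewrite lexx ler01.
    by exists ord0; left; rewrite K0.
  rewrite JK mulr0 sub0r clamp_le0 ?oppr_le0// G0; last exact: cube_collar.
  by rewrite /= /f natural_mapK.
- move=> t ct /=; rewrite wE; last first.
    split; first by apply: cubeK => //; rewrite lexx ler01.
    by exists ord0; right; rewrite K0.
  rewrite JK clamp_ge1; last by lra.
  by rewrite G1 /= /f ?natural_mapK//; exact: cube_collar.
- move=> s t s01 [ct [i ti]] /=; rewrite wE; last first.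
    by split; [exact: cubeK|exists (lift ord0 i); rewrite KS].
  rewrite JK Gb /f ?natural_mapK//; apply: (collar_boundary (i := i)).
  by case: ti => ->; [left|right]; lra.
Qed.

Lemma natural_map_pi0_bij : set_bij (pi0 R) (pi0 R) (pi0_map R f).
Proof.
have cf : continuous f := natural_map_continuous bU.
have fj (x y : realization U) : joined R x y -> joined R (f x) (f y).
  move=> /(joined_homotopic x) h; apply/(joined_homotopic (f x)).
  exact: (homotopic_comp cf h).
have fE (x : realization U) : pi0_map R f [set y | joined R x y] =
    [set m | joined R (f x) m].
  apply/seteqP; split=> m; last by exists x => //; exact: joined_refl.
  move=> [y /= xy]; suff : [set z | joined R (f y) z] m ->
    [set z | joined R (f x) z] m by [].
  by rewrite (joined_class_eq (fj _ _ xy)).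
split.
- by move=> _ [x _ <-]; exists (f x).
- move=> C D; rewrite !inE => -[x _ <-] [y _ <-]; rewrite !fE => xy.
  apply: joined_class_eq; apply/(joined_homotopic x).
  apply: natural_map_homotopic_inj; [exact: cubical_loop0..|].
  suff /(joined_homotopic (f x)) : joined R (f x) (f y) by [].
  have : [set m | joined R (f y) m] (f y) by exact: joined_refl.
  by rewrite -xy.
- move=> _ [m _ <-]; exists [set y | joined R (realize m) y]; first by exists (realize m).
  by rewrite fE /f realizeK.
Qed.

Lemma natural_map_homotopy_group_bij n (x0 : realization U) :
  set_bij (homotopy_group x0) (homotopy_group (f x0)) (@homotopy_map R _ _ f n x0).
Proof.
have cf : continuous f := natural_map_continuous bU.
split.
- move=> _ [u lu <-]; rewrite homotopy_map_class//.
  by exists (f \o u) => //; exact: cubical_loop_comp.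
- move=> C D; rewrite !inE => -[u lu <-] [v lv <-].
  rewrite !homotopy_map_class// => uv; apply: homotopy_class_eq.
  apply: natural_map_homotopic_inj => //; apply: homotopy_class_inj uv.
  exact: cubical_loop_comp.
- move=> _ [w lw <-]; have [u lu uw] := loop_tame_approximation lw.
  exists (homotopy_class x0 u); first by exists u.
  by rewrite homotopy_map_class//; exact: homotopy_class_eq.
Qed.

End Main.

Theorem theorem1 (R : realType) (X : metricType R) (U : set (set X))
    (U_cover : open_cover U) (U_bounded : uniformly_bounded U) :
  weak_homotopy_equivalence R (@natural_map R X U).
Proof.
split; [exact: natural_map_continuous|exact: natural_map_pi0_bij|].
move=> n x0; split; first exact: natural_map_homotopy_group_bij.
by apply: homotopy_map_mul; exact: natural_map_continuous.
Qed.
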